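(* Let $\Sigma$ be a surface and $f$ a differentiable function defined on an interval $\mathcal{J}\subseteq[0,\infty)$. Take a primitive $\varphi(t)$ of $2f'(t^2)$ (for $t\ge 0$ with $t^2\in\mathcal{J}$) such that the function $\sinh\varphi(t)/t$ is well-defined (including at $t=0$ if $0\in\mathcal{J}$). Then every special Weingarten pair $(I,II)$ on $\Sigma$ satisfying $H=f(H^2-K)$ is given by $$I=-\frac{\sinh\varphi(t)}{t}\,Q+\cosh\varphi(t)\,A-\frac{\sinh\varphi(t)}{t}\,\overline{Q},$$ $$II-f(t^2)\,I=\cosh\varphi(t)\,Q-t\,\sinh\varphi(t)\,A+\cosh\varphi(t)\,\overline{Q},$$ where $A$ is a Riemannian metric on $\Sigma$ and $Q$ is a holomorphic 2-form (holomorphic quadratic differential) for $A$ such that the function $t:\Sigma\to[0,\infty)$ defined by $2|Q|=t\,A$ satisfies $t^2\in\mathcal{J}$ on $\Sigma$. In particular, $t^2=H^2-K$.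
   Context: Surfaces are orientable and oriented; differentiable means $C^\infty$. A fundamental pair on a surface $\Sigma$ is a pair $(I,II)$ of real quadratic forms on $\Sigma$ with $I$ a Riemannian metric. Its shape operator $S$ is defined by $II(X,Y)=I(S(X),Y)$; its mean curvature is $H=\frac12\operatorname{tr}S$ and its extrinsic curvature is $K=\det S$. The pair is a Codazzi pair if $\nabla_XSY-\nabla_YSX-S[X,Y]=0$ for all vector fields $X,Y$, where $\nabla$ is the Levi-Civita connection of $I$. A Codazzi pair is a special Weingarten pair if there is a differentiable function $f$ defined on an interval $\mathcal{J}\subseteq[0,\infty)$ such that $H=f(H^2-K)$. If $z$ is a local conformal parameter for $A$, with $A=2\lambda|dz|^2$ and $Q=q\,dz^2$, then $|Q|$ denotes $|q|\,|dz|^2$, so $2|Q|=tA$ means $t=|q|/\lambda$. *)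

(* Defs.v *)
From HB Require Import structures.
From mathcomp Require Import all_boot all_order all_algebra.
From mathcomp Require Import all_classical all_reals all_analysis.
From mathcomp Require Import complex.

Set Implicit Arguments.
Unset Strict Implicit.
Unset Printing Implicit Defensive.

Import Order.TTheory GRing.Theory Num.Theory.
Import numFieldNormedType.Exports.
Local Open Scope classical_set_scope.
Local Open Scope ring_scope.

(* Points and tangent vectors of the coordinate plane are row vectors: with
   the library's Jacobian, 'D_v F x = v *m 'J F x. *)
Section smooth_maps.
Context {R : realType}.

Fixpoint class_C {V : normedModType R} (n : nat) (W : set 'rV[R]_2)
    (F : 'rV[R]_2 -> V) : Prop :=
  if n is m.+1 then
    (forall x, W x -> differentiable F x) /\
    (forall j : 'I_2, class_C m W ('D_('e_j) F))
  else forall x, W x -> {for x, continuous F}.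

Definition smooth_on {V : normedModType R} (W : set 'rV[R]_2)
    (F : 'rV[R]_2 -> V) : Prop :=
  forall n, class_C n W F.

End smooth_maps.

(* Differentiation of functions of one real variable relative to a
   nondegenerate interval, hence one-sided at an endpoint of the interval. *)
Section functions_on_an_interval.
Context {R : realType}.

Definition quotient_filter_at (D : set R) (f : R -> R) (x : R) :=
  (fun y => (f y - f x) / (y - x)) @ within D (dnbhs x).

Definition derive_within (D : set R) (f : R -> R) (x : R) : R :=
  lim (quotient_filter_at D f x).

Definition smooth_within (D : set R) (f : R -> R) : Prop :=
  forall n x, D x ->
    cvg (quotient_filter_at D (iter n (derive_within D) f) x).

Definition primitive_within (D : set R) (g F : R -> R) : Prop :=
  forall x, D x -> quotient_filter_at D F x --> g x.

Definition nondegenerate_interval (J : set R) : Prop :=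
  is_interval J /\ exists a b, [/\ J a, J b & a < b].

Definition sinh (x : R) : R := (expR x - expR (- x)) / 2.
Definition cosh (x : R) : R := (expR x + expR (- x)) / 2.

(* [sinh_ratio phi t] is sinh (phi t) / t, continuously extended to t = 0. *)
Definition sinh_ratio (phi : R -> R) (t : R) : R :=
  if t == 0 then lim (sinh (phi s) / s @[s --> 0^'+])
  else sinh (phi t) / t.

End functions_on_an_interval.

Section charts.
Context {R : realType} {M : topologicalType}.

(* [cmap] is meaningful on [cdom] only, and [cinv] on the image of [cdom]. *)
Record chart := Chart {
  cdom : set M;
  cmap : M -> 'rV[R]_2;
  cinv : 'rV[R]_2 -> M;
  cdom_open : open cdom;
  cimg_open : open (cmap @` cdom);
  cmapK : forall p, cdom p -> cinv (cmap p) = p;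
  cmap_continuous : {within cdom, continuous cmap};
  cinv_continuous : {within cmap @` cdom, continuous cinv} }.

Definition cimg (c : chart) : set 'rV[R]_2 := cmap c @` cdom c.

Definition overlap (c d : chart) : set 'rV[R]_2 :=
  cmap c @` (cdom c `&` cdom d).

Definition transition (c d : chart) : 'rV[R]_2 -> 'rV[R]_2 :=
  cmap d \o cinv c.

Definition oriented_transition (c d : chart) : Prop :=
  smooth_on (overlap c d) (transition c d) /\
  forall x, overlap c d x -> 0 < \det ('J (transition c d) x).

End charts.
Arguments chart : clear implicits.

(* An oriented smooth surface: [atlas] is a maximal oriented smooth atlas, so
   its members are exactly the positively oriented local parameters. *)
Record surface (R : realType) := Surface {
  carrier :> topologicalType;
  surface_hausdorff : hausdorff_space carrier;
  surface_countable : @second_countable carrier;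
  atlas : set (chart R carrier);
  atlas_cover : forall p : carrier, exists2 c, atlas c & cdom c p;
  atlas_oriented : forall c d, atlas c -> atlas d -> oriented_transition c d;
  atlas_maximal : forall c,
    (forall d, atlas d -> oriented_transition c d /\ oriented_transition d c) ->
    atlas c }.

(* Tensor fields are given by their components in each chart of the atlas, as
   functions of the coordinates, subject to the transformation law. *)
Section tensors.
Context {R : realType} (S : surface R).

Record vector_field := VectorField {
  vcoef :> chart R S -> 'rV[R]_2 -> 'rV[R]_2;
  vcoef_transition : forall c d x, atlas c -> atlas d -> overlap c d x ->
    vcoef d (transition c d x) = vcoef c x *m 'J (transition c d) x;
  vcoef_smooth : forall c, atlas c -> smooth_on (cimg c) (vcoef c) }.

(* A quadratic form is given by its symmetric matrix: the matrix
   ((E, F), (F, G)) stands for E dx^2 + 2 F dx dy + G dy^2. *)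
Record quadratic_form := QuadraticForm {
  qcoef :> chart R S -> 'rV[R]_2 -> 'M[R]_2;
  qcoef_sym : forall c x, atlas c -> cimg c x -> (qcoef c x)^T = qcoef c x;
  qcoef_transition : forall c d x, atlas c -> atlas d -> overlap c d x ->
    qcoef c x = 'J (transition c d) x *m qcoef d (transition c d x)
                *m ('J (transition c d) x)^T;
  qcoef_smooth : forall c (i j : 'I_2), atlas c ->
    smooth_on (cimg c) ((fun x => qcoef c x i j) : 'rV[R]_2 -> R^o) }.

Definition riemannian_metric (g : quadratic_form) : Prop :=
  forall c x (v : 'rV[R]_2), atlas c -> cimg c x -> v != 0 ->
    0 < (v *m g c x *m v^T) 0 0.

Record fundamental_pair := FundamentalPair {
  formI : quadratic_form;
  formII : quadratic_form;
  formI_metric : riemannian_metric formI }.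

End tensors.

Section codazzi_pairs.
Context {R : realType} {S : surface R}.
Implicit Types (P : fundamental_pair S) (c : chart R S).

(* Matrix of the shape operator, acting on row vectors by v |-> v *m _: the
   identity v *m II *m w^T = (v *m shape) *m I *m w^T forces shape * I = II. *)
Definition shape P c (x : 'rV[R]_2) : 'M[R]_2 :=
  formII P c x *m invmx (formI P c x).

Definition mean_curvature P c x : R := \tr (shape P c x) / 2.

Definition extrinsic_curvature P c x : R := \det (shape P c x).

Definition christoffel (g : 'rV[R]_2 -> 'M[R]_2) (k i j : 'I_2)
    (x : 'rV[R]_2) : R :=
  2^-1 * \sum_(l < 2) invmx (g x) k l *
    ('D_('e_i) ((fun y => g y j l) : 'rV[R]_2 -> R^o) x
     + 'D_('e_j) ((fun y => g y i l) : 'rV[R]_2 -> R^o) x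
     - 'D_('e_l) ((fun y => g y i j) : 'rV[R]_2 -> R^o) x).

(* The Levi-Civita derivative of Y along X, in the coordinates of a chart. *)
Definition levi_civita (g : 'rV[R]_2 -> 'M[R]_2) (X Y : 'rV[R]_2 -> 'rV[R]_2)
    (x : 'rV[R]_2) : 'rV[R]_2 :=
  'D_(X x) Y x +
  \row_(k < 2) \sum_(i < 2) \sum_(j < 2)
    christoffel g k i j x * X x 0 i * Y x 0 j.

Definition lie_bracket (X Y : 'rV[R]_2 -> 'rV[R]_2) (x : 'rV[R]_2) :
    'rV[R]_2 :=
  'D_(X x) Y x - 'D_(Y x) X x.

Definition codazzi_pair P : Prop :=
  forall (X Y : vector_field S) c x, atlas c -> cimg c x ->
    let SX y := X c y *m shape P c y in
    let SY y := Y c y *m shape P c y in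
    levi_civita (formI P c) (X c) SY x - levi_civita (formI P c) (Y c) SX x
      - lie_bracket (X c) (Y c) x *m shape P c x = 0.

Definition special_weingarten_pair (J : set R) (f : R -> R) P : Prop :=
  codazzi_pair P /\
  forall c x, atlas c -> cimg c x ->
    let H := mean_curvature P c x in
    let K := extrinsic_curvature P c x in
    J (H ^+ 2 - K) /\ H = f (H ^+ 2 - K).

End codazzi_pairs.

Section quadratic_differentials.
Context {R : realType} {S : surface R}.
Local Open Scope complex_scope.

Definition complex_mx (B : 'M[R]_2) : 'M[R[i]]_2 := map_mx (real_complex R) B.

(* A complex-valued quadratic form, as real part + 'i * imaginary part. *)
Record complex_form := ComplexForm {
  form_re : quadratic_form S;
  form_im : quadratic_form S }.

Definition ccoef (Q : complex_form) (c : chart R S) (x : 'rV[R]_2) :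
    'M[R[i]]_2 :=
  complex_mx (form_re Q c x) + 'i *: complex_mx (form_im Q c x).

Definition conj_mx (B : 'M[R[i]]_2) : 'M[R[i]]_2 := map_mx (@conjc R) B.

Definition plane_point (z : R[i]) : 'rV[R]_2 :=
  \row_j (if j == 0 then complex.Re z else complex.Im z).

(* The covector dz = dx + i dy and the matrix of the form dz^2; the matrix of
   |dz|^2 = dx^2 + dy^2 is the identity. *)
Definition dz : 'rV[R[i]]_2 := \row_j (if j == 0 then 1 else 'i).
Definition dz2 : 'M[R[i]]_2 := dz^T *m dz.

Definition holomorphic_on (W : set R[i]) (q : R[i] -> R[i]) : Prop :=
  forall z, W z -> derivable (q : R[i]^o -> R[i]^o) z 1.

(* z = x + i y is a conformal parameter: A = 2 lambda |dz|^2. The lambda is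
   positive and smooth because A is a smooth Riemannian metric. *)
Definition conformal_parameter (A : quadratic_form S) (c : chart R S) : Prop :=
  atlas c /\
  forall x, cimg c x -> exists lambda : R, A c x = (2 * lambda)%:M.

(* By the existence of isothermal coordinates, conformal parameters cover the
   surface, so that quantifying over all of them is never vacuous. *)
Definition holomorphic_differential (A : quadratic_form S) (Q : complex_form) :
    Prop :=
  forall c, conformal_parameter A c ->
    exists2 q : R[i] -> R[i], holomorphic_on (plane_point @^-1` cimg c) q &
      forall z, cimg c (plane_point z) -> ccoef Q c (plane_point z) = q z *: dz2.

(* 2 |Q| = t A *)
Definition norm_ratio (A : quadratic_form S) (Q : complex_form) (t : S -> R) :
    Prop :=
  forall c x (lambda : R) (q : R[i]), conformal_parameter A c -> cimg c x ->
    A c x = (2 * lambda)%:M -> ccoef Q c x = q *: dz2 ->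
    (t (cinv c x))%:C = `|q| / lambda%:C.

End quadratic_differentials.

(* Main.v *)
Require Import Defs.
From HB Require Import structures.
From mathcomp Require Import all_boot all_order all_algebra.
From mathcomp Require Import all_classical all_reals all_analysis.
From mathcomp Require Import complex.
From mathcomp Require Import ring lra.

Set Implicit Arguments.
Unset Strict Implicit.
Unset Printing Implicit Defensive.

Import Order.TTheory GRing.Theory Num.Theory.
Import numFieldNormedType.Exports.
Local Open Scope classical_set_scope.
Local Open Scope ring_scope.

(* Put u = H^2 - K, t = sqrt u, C = cosh phi(t), s = sinh phi(t) / t, and let
   S0 = S - H be the traceless shape operator, so that S0^2 = u.  Because
   cosh^2 - sinh^2 = 1, the two formulas of the statement can be solved for A and
   Q: A = C I + s (II - H I) and 2 Re Q = u s I + C (II - H I), while Im Q, the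
   rotation of Re Q by the complex structure of A, does not depend on phi.
   These forms are smooth across umbilics: as functions of u, C' = f' s and
   2 u s' + s = 2 C f', and the solution of such a singular equation that stays
   bounded at u = 0 is as smooth as its right-hand side.  In a parameter z = x + i y
   conformal for A = rho |dz|^2 one has 2 Re Q = rho S0, and, modulo
   C^2 - u s^2 = 1 and the equations for C and s, the components of the Codazzi
   expression for I are exactly the Cauchy-Riemann defects of Q divided by rho. *)

(** * Differentiation within a subset of the line *)

Section within_derivatives.
Context {R : realType}.
Implicit Types (J D : set R) (F G : R -> R) (x L M : R).

(** For [t > 0] the operator [C + s S0] is the exponential of [(phi t / t) S0], with eigenvalues
    [exp (phi t)] and [exp (- phi t)]. So [A] is [I] composed with a positive operator of
    determinant 1 and has the area form of [I], while [2 Re Q] is [A] composed with [S0] itself;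
    this is the origin of [2 |Q| = t A]. The obstacle is the umbilic set: there [t] need not be
    differentiable, and the value 0 of [u] is an endpoint of [J]. Derivatives of functions of [u]
    are therefore taken relative to [J], and at an umbilic no derivative is taken through [t]. [A],
    [Re Q] and [Im Q] are built from globally defined tensors with invariant coefficients, so
    nothing is glued over isothermal charts; conformal parameters occur only as the charts in which
    holomorphy and [2 |Q| = t A] have to be tested. *)

Definition within_deriv J F x L := quotient_filter_at J F x --> L.

(** Multiplying the quotient out admits [y = x]. The chain rule needs this, since the inner function
    may return to its value at the base point. *)
Lemma within_derivP J F x L :
  within_deriv J F x L <->
  forall e : R, 0 < e -> exists2 d : R, 0 < d & forall y, J y -> `|y - x| < d ->
    `|F y - F x - L * (y - x)| <= e * `|y - x|.
Proof.
split=> [/cvgrPdist_le FL e e0|H].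
  have /= [d /= d0 hd] := FL e e0.
  exists d => // y Jy yx; have [->|y_x] := eqVneq y x.
    by rewrite !subrr mulr0 subr0 normr0 mulr0.
  have := hd y; rewrite /ball_ /= distrC => /(_ yx y_x Jy).
  have yx0 : y - x != 0 by rewrite subr_eq0.
  have -> : F y - F x - L * (y - x) = - ((L - (F y - F x) / (y - x)) * (y - x)).
    by field.
  by rewrite normrN normrM => h; rewrite ler_wpM2r.
apply/cvgrPdist_le => e e0; have [d d0 hd] := H e e0.
exists d => //= y; rewrite /ball_ /= distrC => yx y_x Jy.
have yx0 : y - x != 0 by rewrite subr_eq0.
have -> : L - (F y - F x) / (y - x) = - (F y - F x - L * (y - x)) / (y - x).
  by field.
by rewrite normrM normrN normrV ?unitfE// ler_pdivrMr ?normr_gt0// hd.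
Qed.

Lemma within_deriv_cvg J F x L :
  within_deriv J F x L -> F @ within J (nbhs x) --> F x.
Proof.
move=> /within_derivP/(_ 1 ltr01)[d d0 hd].
apply/cvgrPdist_le => e e0.
have c0 : 0 < 1 + `|L| by rewrite ltr_pwDl.
exists (Num.min d (e / (1 + `|L|))) => /=.
  by rewrite lt_min d0 divr_gt0.
move=> y; rewrite /ball_ /= distrC lt_min => /andP[yd ye] Jy.
rewrite distrC.
have -> : F y - F x = (F y - F x - L * (y - x)) + L * (y - x) by ring.
apply: (le_trans (ler_normD _ _)).
apply: (@le_trans _ _ ((1 + `|L|) * `|y - x|)).
  by rewrite mulrDl lerD ?normrM// hd.
by rewrite mulrC -ler_pdivlMr// ltW.
Qed.

Lemma within_deriv_id J x : within_deriv J id x 1.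
Proof.
apply/within_derivP => e e0; exists 1 => // y _ _.
by rewrite mul1r subrr normr0 mulr_ge0// ltW.
Qed.

Lemma within_deriv_cst J c x : within_deriv J (cst c) x 0.
Proof.
apply/within_derivP => e e0; exists 1 => // y _ _.
by rewrite /cst/= mul0r !subrr normr0 mulr_ge0// ltW.
Qed.

Lemma within_derivD J F G x L M :
  within_deriv J F x L -> within_deriv J G x M ->
  within_deriv J (fun y => F y + G y) x (L + M).
Proof.
move=> FL GM; rewrite /within_deriv /quotient_filter_at.
under eq_fun do rewrite opprD addrACA mulrDl.
exact: cvgD.
Qed.

Lemma within_derivM J F G x L M :
  within_deriv J F x L -> within_deriv J G x M ->
  within_deriv J (fun y => F y * G y) x (L * G x + F x * M).
Proof.
move=> FL GM; rewrite /within_deriv /quotient_filter_at.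
have -> : (fun y => (F y * G y - F x * G x) / (y - x)) =
   (fun y => (F y - F x) / (y - x) * G x + F y * ((G y - G x) / (y - x))).
  by apply/funext => y; ring.
apply: cvgD; first exact: cvgMl.
apply: cvgM => //.
have := within_deriv_cvg FL; apply: cvg_trans.
apply: cvg_app => A; rewrite /within/= => -[e e0 he]; exists e => // y ye _.
exact: he.
Qed.

Lemma within_deriv_comp D J F G x L M : J x -> (forall y, J y -> D (G y)) ->
  within_deriv D F (G x) M -> within_deriv J G x L ->
  within_deriv J (F \o G) x (M * L).
Proof.
move=> Jx JD /within_derivP FM GL; have /within_derivP GL' := GL.
apply/within_derivP => e e0.
have L0 : 0 < 1 + `|L| by rewrite ltr_pwDl.
have M0 : 0 < 1 + `|M| by rewrite ltr_pwDl.
have [d d0 hd] := FM (e / 2 / (1 + `|L|)) (divr_gt0 (divr_gt0 e0 (ltr0Sn _ _)) L0).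
have [d1 d10 hd1] := GL' (e / 2 / (1 + `|M|)) (divr_gt0 (divr_gt0 e0 (ltr0Sn _ _)) M0).
have [d2 d20 hd2] := GL' 1 ltr01.
have /cvgrPdist_lt/(_ d d0)/= [d3 /= d30 hd3] := within_deriv_cvg GL.
exists (Num.min d1 (Num.min d2 d3)); first by rewrite !lt_min d10 d20.
move=> y Jy; rewrite !lt_min => /and3P[y1 y2 y3] /=.
have Gd : `|G y - G x| < d by rewrite distrC; apply: hd3; rewrite // /ball_ /= distrC.
have Gl : `|G y - G x| <= (1 + `|L|) * `|y - x|.
  have -> : G y - G x = (G y - G x - L * (y - x)) + L * (y - x) by ring.
  by rewrite (le_trans (ler_normD _ _))// mulrDl lerD ?normrM// hd2.
have -> : F (G y) - F (G x) - M * L * (y - x) =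
  (F (G y) - F (G x) - M * (G y - G x)) + M * (G y - G x - L * (y - x)) by ring.
apply: (le_trans (ler_normD _ _)).
rewrite (splitr e) mulrDl lerD//.
  apply: (le_trans (hd _ (JD _ Jy) Gd)).
  apply: (@le_trans _ _ (e / 2 / (1 + `|L|) * ((1 + `|L|) * `|y - x|))).
    by rewrite ler_wpM2l// divr_ge0 ?divr_ge0 ?ltW.
  by rewrite mulrA divfK ?gt_eqF.
rewrite normrM.
apply: (@le_trans _ _ (`|M| * (e / 2 / (1 + `|M|) * `|y - x|))).
  by rewrite ler_wpM2l// hd1.
rewrite mulrA ler_wpM2r// mulrA ler_pdivrMr// mulrC ler_wpM2l//.
  by rewrite divr_ge0 ?ltW.
by rewrite lerDr.
Qed.

Lemma within_deriv_near J F G x L : J x ->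
  (\forall y \near x, J y -> F y = G y) ->
  within_deriv J F x L -> within_deriv J G x L.
Proof.
move=> Jx FG; apply: cvg_trans; apply: near_eq_cvg.
have FGx := nbhs_singleton FG Jx.
by case: FG => d d0 hd; exists d => // y yd _ Jy /=; rewrite FGx hd.
Qed.

Lemma is_derive_within_deriv J F x L :
  is_derive x 1 F L -> within_deriv J F x L.
Proof.
move=> [dF FL]; apply/within_derivP => e e0.
have : h^-1 *: ((F \o shift x) (h *: 1) - F x) @[h --> 0^'] --> L.
  by rewrite -FL; exact: dF.
move=> /cvgrPdist_le/(_ e e0)[d /= d0 hd]; exists d => // y _ yx.
have [->|y_x] := eqVneq y x.
  by rewrite !subrr mulr0 subr0 normr0 mulr0.
have yx0 : y - x != 0 by rewrite subr_eq0.
have := hd (y - x); rewrite /ball_ /= sub0r normrN => /(_ yx yx0).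
rewrite /GRing.scale/= mulr1 subrK.
have -> : F y - F x - L * (y - x) = - ((L - (y - x)^-1 * (F y - F x)) * (y - x)).
  by field.
by rewrite normrN normrM => h; rewrite ler_wpM2r.
Qed.

Lemma within_deriv_is_derive J F x L : nbhs x J ->
  within_deriv J F x L -> is_derive x 1 F L.
Proof.
move=> nJ /within_derivP H.
suff FL : h^-1 *: ((F \o shift x) (h *: 1) - F x) @[h --> 0^'] --> L.
  by split; [apply: cvgP FL|exact: cvg_lim FL].
apply/cvgrPdist_le => e e0; have [d d0 hd] := H e e0.
move: nJ => [d1 /= d10 hJ].
exists (Num.min d d1) => /=; first by rewrite lt_min d0.
move=> h; rewrite /ball_ /= sub0r normrN lt_min => /andP[h1 h2] h0.
rewrite /GRing.scale/= mulr1.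
have := hd (h + x); rewrite addrK => /(_ _ h1) H1.
have {}H1 : `|F (h + x) - F x - L * h| <= e * `|h|.
  by apply: H1; apply: hJ; rewrite /ball_ /= distrC addrK.
have -> : L - h^-1 * (F (h + x) - F x) = - (F (h + x) - F x - L * h) / h by field.
by rewrite normrM normrN normfV ler_pdivrMr ?normr_gt0.
Qed.

Lemma within_derivX J n x :
  within_deriv J (fun y => y ^+ n.+1) x (n.+1%:R * x ^+ n).
Proof.
elim: n => [|n IH].
  by rewrite expr0 mulr1; exact: within_deriv_id.
have := within_derivM (within_deriv_id J x) IH.
have <- : n.+2%:R * x ^+ n.+1 = 1 * x ^+ n.+1 + x * (n.+1%:R * x ^+ n).
  by rewrite mul1r mulrCA -exprS -[n.+2]add1n natrD mulrDl mul1r.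
apply: cvg_trans; apply: near_eq_cvg; apply: nearW => y.
by rewrite [y ^+ n.+2]exprS [x ^+ n.+2]exprS.
Qed.

Lemma within_derivV J x : x != 0 ->
  within_deriv J (fun y => y^-1) x (- x ^- 2).
Proof.
move=> x0; have dV := @derivableV R R id x 1 x0 (@derivable_id _ R^o x 1).
apply: is_derive_within_deriv; split => //.
have := @deriveV R R id x 1 x0 (@derivable_id _ R^o x 1).
by rewrite derive_id /GRing.scale /= mulr1 => <-.
Qed.

End within_derivatives.

Arguments within_deriv_id {R} J x.
Arguments within_deriv_cst {R} J c x.
Arguments within_derivX {R} J n x.
Arguments within_derivV {R} J {x} _.
Arguments is_derive_within_deriv {R} J {F x L} _.

(** * Smoothness within a subset and a singular linear equation *)

Section within_C.
Context {R : realType}.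
Implicit Types (J : set R) (F G h r e : R -> R).

(** The derivative is an existential witness and not the limit chosen by [derive_within], so closure
    under sums, products and composition never has to identify an iterated [derive_within]. *)
Fixpoint within_C n J F : Prop :=
  if n is m.+1 then
    exists2 F', (forall x, J x -> within_deriv J F x (F' x)) &
      within_C m J F'
  else forall x, J x -> F @ within J (nbhs x) --> F x.

Lemma within_CW n J F : within_C n.+1 J F -> within_C n J F.
Proof.
elim: n F => [F [F' FF' _] x Jx|n IH F [F' FF' CF']].
  exact: within_deriv_cvg (FF' _ Jx).
by exists F' => //; exact: IH.
Qed.

Lemma within_C_cst n J (c : R) : within_C n J (cst c).
Proof.
elim: n c => [c x Jx|n IH c]; first exact: cvg_cst.
by exists (cst 0) => // x Jx; exact: within_deriv_cst.
Qed.

Lemma within_CD n J F G : within_C n J F -> within_C n J G ->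
  within_C n J (fun x => F x + G x).
Proof.
elim: n F G => [F G CF CG x Jx|n IH F G [F' FF' CF'] [G' GG' CG']].
  by apply: cvgD; [exact: CF|exact: CG].
exists (fun x => F' x + G' x); last exact: IH.
by move=> x Jx; apply: within_derivD; [exact: FF'|exact: GG'].
Qed.

Lemma within_CM n J F G : within_C n J F -> within_C n J G ->
  within_C n J (fun x => F x * G x).
Proof.
elim: n F G => [F G CF CG x Jx|n IH F G CF CG].
  by apply: cvgM; [exact: CF|exact: CG].
have [[F' FF' CF'] [G' GG' CG']] := (CF, CG).
exists (fun x => F' x * G x + F x * G' x).
  by move=> x Jx; apply: within_derivM; [exact: FF'|exact: GG'].
by apply: within_CD; apply: IH => //; exact: within_CW.
Qed.

Lemma smooth_within_C n k J F : smooth_within J F ->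
  within_C n J (iter k (derive_within J) F).
Proof.
move=> sF; elim: n k => [k x Jx|n IH k].
  by apply: within_deriv_cvg (sF k x Jx).
exists (iter k.+1 (derive_within J) F) => // x Jx.
exact: sF.
Qed.

(* For [t = sqrt u], the derivative of [t ^+ m.+1 * r (t ^+ 2)] is
   [t ^+ m * e (t ^+ 2)]; the mean value inequality from 0 concludes. *)
Lemma singular_ode_bound m k (d c : R) r e :
  (forall u : R, 0 < u < d -> is_derive u 1 r ((e u - m.+1%:R * r u) / (2 * u))) ->
  t ^+ m.+1 * r (t ^+ 2) @[t --> 0^'+] --> 0 ->
  (forall u : R, 0 < u < d -> `|e u| <= c * u ^+ k) ->
  forall u : R, 0 < u < d -> `|r u| <= c * u ^+ k.
Proof.
move=> dr r0 ec u ud.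
have [u0 {}ud] := andP ud.
pose K t := t ^+ m.+1 * r (t ^+ 2).
pose t := Num.sqrt u.
have t0 : 0 < t by rewrite sqrtr_gt0.
have tu : t ^+ 2 = u by rewrite sqr_sqrtr// ltW.
have c0 : 0 <= c.
  have := le_trans (normr_ge0 _) (ec u _); rewrite u0 ud => /(_ erefl).
  by rewrite pmulr_lge0// exprn_gt0.
have dK s : 0 < s <= t -> is_derive s 1 K (s ^+ m * e (s ^+ 2)).
  move=> /andP[s0 st].
  have s2 : 0 < s ^+ 2 < d.
    rewrite exprn_gt0//= (le_lt_trans _ ud)// -tu.
    by rewrite ler_pXn2r// nnegrE ltW.
  have := dr _ s2 => dr'.
  apply: (@within_deriv_is_derive _ setT); first exact: filterT.
  have Tm := within_derivX setT m s.
  have T1 := within_derivX setT 1 s.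
  have Tr := is_derive_within_deriv setT dr'.
  have := within_derivM Tm (@within_deriv_comp _ setT setT r (fun y => y ^+ 2) s
    _ _ I (fun _ _ => I) Tr T1).
  rewrite /=; congr within_deriv; rewrite expr1.
  rewrite (_ : s ^+ 2 = s * s)// exprS.
  by field; rewrite gt_eqF.
(* On the interval the derivative of [K] is at most [c * t ^+ (m + 2 * k)]; the last factor [t]
   bounds the length [t - s]. *)
have Kt s : 0 < s < t -> `|K t - K s| <= c * t ^+ (m.+1 + 2 * k).
  move=> /andP[s0 st].
  have cK : {within `[s, t], continuous K}.
    apply: derivable_within_continuous => y; rewrite in_itv/= => /andP[sy yt].
    by have [] := dK y; rewrite ?yt ?(lt_le_trans s0 sy).
  have [|y] := @MVT _ K (fun s => s ^+ m * e (s ^+ 2)) s t st _ cK.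
    move=> y; rewrite in_itv/= => /andP[sy yt].
    by apply: dK; rewrite (lt_trans s0 sy) ltW.
  rewrite in_itv/= => /andP[sy yt] ->.
  have y0 := lt_trans s0 sy.
  rewrite normrM addSn (exprSr t) mulrA; apply: ler_pM => //.
    rewrite normrM (ger0_norm (exprn_ge0 _ (ltW y0))).
    apply: (@le_trans _ _ (y ^+ m * (c * (y ^+ 2) ^+ k))).
      rewrite (ler_wpM2l (exprn_ge0 _ (ltW y0)))// ec// exprn_gt0//=.
      by rewrite (le_lt_trans _ ud)// -tu ler_pXn2r// ?nnegrE ltW.
    rewrite mulrCA -exprM -exprD ler_wpM2l//.
    by rewrite lerXn2r// ?nnegrE ltW.
  by rewrite ger0_norm ?subr_ge0 ?(ltW st)// gerBl ltW.
(* The bound does not involve [s], and [K s] tends to 0 with [s], so the term [K s] costs only an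
   arbitrary [eta]. *)
have {}Kt : `|K t| <= c * t ^+ (m.+1 + 2 * k).
  apply/ler_addgt0Pr => eta eta0.
  have /cvgrPdist_le/(_ eta eta0) := r0 => H.
  have [s [/= s0 st Hs]] : exists s, [/\ 0 < s, s < t & `|K s| <= eta].
    near (0 : R)^'+ => s; exists s; split=> //.
    rewrite -normrN -sub0r; near: s; exact: H.
  rewrite -[K t](subrK (K s)) (le_trans (ler_normD _ _))// lerD// Kt//.
  by rewrite s0.
move: Kt; rewrite /K tu normrM exprD mulrCA exprM tu.
by rewrite (ger0_norm (exprn_ge0 _ (ltW t0))) ler_pM2l ?exprn_gt0.
Unshelve. all: by end_near. Qed.

Lemma exprn_cvg0 m : (t : R) ^+ m.+1 @[t --> 0^'+] --> 0.
Proof.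
apply: cvg_within_filter; have := @exprn_continuous R m.+1 0.
by rewrite /continuous_at expr0n.
Qed.

(** By linearity: [h 0 + l * u] solves the equation with right-hand side [F 0 + (m + 3) l u], where
    [m + 3] is 2 from [2 u h'] plus [m + 1]. Subtracting it leaves the same equation for the Taylor
    remainders. The case [k = 0], [l = 0] yields continuity at 0, the case [k = 1]
    differentiability. *)
Lemma singular_ode_taylor m k (d l c : R) F h :
  (forall u : R, 0 < u < d ->
    is_derive u 1 h ((F u - m.+1%:R * h u) / (2 * u))) ->
  h 0 = F 0 / m.+1%:R ->
  t ^+ m.+1 * h (t ^+ 2) @[t --> 0^'+] --> 0 ->
  (forall u : R, 0 < u < d -> `|F u - F 0 - m.+3%:R * l * u| <= c * u ^+ k) ->
  forall u : R, 0 < u < d -> `|h u - h 0 - l * u| <= c * u ^+ k.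
Proof.
move=> dh h0 hl Fc.
apply: (@singular_ode_bound m k d c _ (fun u => F u - F 0 - m.+3%:R * l * u)).
- move=> u ud; have [u0 _] := andP ud.
  apply: (@within_deriv_is_derive _ setT); first exact: filterT.
  have Th := is_derive_within_deriv setT (dh u ud).
  have Tl := within_derivM (within_deriv_cst setT (- l) u)
    (within_deriv_id setT u).
  have := within_derivD (within_derivD Th (within_deriv_cst setT (- h 0) u)) Tl.
  have -> : (fun y => h y + cst (- h 0) y + cst (- l) y * id y) =
      (fun y => h y - h 0 - l * y) by apply/funext => y; rewrite /= mulNr.
  congr within_deriv; rewrite h0 /= -[m.+3]addn2 natrD.
  by field; rewrite !gt_eqF.
- have -> : (fun t => t ^+ m.+1 * (h (t ^+ 2) - h 0 - l * t ^+ 2)) =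
      (fun t => t ^+ m.+1 * h (t ^+ 2) + (- h 0) * t ^+ m.+1 + (- l) * t ^+ m.+3).
    by apply/funext => t; rewrite -[m.+3]addn2 (exprD t m.+1 2); ring.
  rewrite -[X in _ --> X](_ : 0 + (- h 0) * 0 + (- l) * 0 = 0); last by ring.
  by do 2 (apply: cvgD; last by apply: cvgMr; exact: exprn_cvg0).
- exact: Fc.
Qed.

(* The derivative of [h] solves the same equation with [m.+2] for [m] and the
   derivative of [F] for [F]. *)
Lemma singular_ode_within_C n m J F h b :
  is_interval J -> (forall u, J u -> 0 <= u) -> J b -> 0 < b ->
  within_C n J F ->
  (forall u, J u -> 0 < u ->
    within_deriv J h u ((F u - m.+1%:R * h u) / (2 * u))) ->
  (J 0 -> h 0 = F 0 / m.+1%:R) ->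
  (J 0 -> t ^+ m.+1 * h (t ^+ 2) @[t --> 0^'+] --> 0) ->
  within_C n J h.
Proof.
move=> itvJ J0 Jb b0.
have nJ : J 0 -> forall u, 0 < u < b -> nbhs u J.
  move=> J00 u ub; apply: (@filterS _ _ _ `]0, b[%classic).
    move=> y/=; rewrite in_itv/= => /andP[y0 yb].
    by apply: (itvJ _ _ J00 Jb); rewrite !ltW.
  by apply: open_nbhs_nbhs; split; [exact: interval_open|rewrite /= in_itv].
have taylor m' F' h' k d l c : J 0 -> d <= b ->
  (forall u, J u -> 0 < u ->
    within_deriv J h' u ((F' u - m'.+1%:R * h' u) / (2 * u))) ->
  h' 0 = F' 0 / m'.+1%:R ->
  t ^+ m'.+1 * h' (t ^+ 2) @[t --> 0^'+] --> 0 ->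
  (forall u : R, J u -> `|u| < d -> `|F' u - F' 0 - m'.+3%:R * l * u| <= c * `|u| ^+ k) ->
  forall u, J u -> `|u| < d -> 0 < u -> `|h' u - h' 0 - l * u| <= c * `|u| ^+ k.
  move=> J00 db dh h0 hl Fc u Ju ud u0; rewrite (ger0_norm (ltW u0)).
  apply: (@singular_ode_taylor m' k d l c F' h') => //.
  - move=> v /andP[v0 vd].
    have nv : nbhs v J by apply: nJ; rewrite // v0 (lt_le_trans vd).
    exact: within_deriv_is_derive nv (dh v (nbhs_singleton nv) v0).
  - move=> v /andP[v0 vd]; have := Fc v; rewrite (ger0_norm (ltW v0)); apply => //.
    by apply: (itvJ _ _ J00 Jb); rewrite !ltW//= (lt_le_trans vd).
  - by rewrite u0 -(ger0_norm (ltW u0)).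
elim: n m F h => [|n IH] m F h.
  move=> CF dh h0 hl x Jx.
  have := J0 x Jx; rewrite le_eqVlt => /predU1P[x0|x0]; last first.
    exact: within_deriv_cvg (dh _ Jx x0).
  rewrite -{}x0 in Jx *.
  apply/cvgrPdist_le => e e0.
  have /cvgrPdist_le/(_ e e0)[d /= d0 hd] := CF _ Jx.
  exists (Num.min d b) => /=; first by rewrite lt_min d0.
  move=> u; rewrite /ball_ /= sub0r normrN lt_min => /andP[ud ub] Ju.
  have := J0 u Ju; rewrite le_eqVlt => /predU1P[<-|u0].
    by rewrite subrr normr0 ltW.
  have := @taylor m F h 0 (Num.min d b) 0 e Jx _ dh (h0 Jx) (hl Jx) _ u Ju _ u0.
  rewrite mul0r subr0 expr0 mulr1 distrC; apply.
  - by rewrite ge_min lexx orbT.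
  - move=> v Jv; rewrite lt_min => /andP[vd vb]; rewrite mulr0 mul0r subr0.
    by rewrite distrC; apply: hd; rewrite // /ball_ /= sub0r normrN.
  - by rewrite lt_min ud.
move=> CF dh h0 hl; have [F' FF' CF'] := CF.
(* The value at 0 is the only candidate: the differentiated equation [2 u h'' + (m + 3) h' = F'] at
   [u = 0] gives [F' 0 / (m + 3)]. *)
pose h1 u := if u == 0 then F' 0 / m.+3%:R else (F u - m.+1%:R * h u) / (2 * u).
exists h1.
  move=> x Jx; have := J0 x Jx; rewrite le_eqVlt => /predU1P[x0|x0]; last first.
    by rewrite /h1 gt_eqF//; exact: dh.
  rewrite -{}x0 in Jx *; rewrite /h1 eqxx.
  apply/within_derivP => e e0.
  have /within_derivP/(_ e e0)[d d0 hd] := FF' _ Jx.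
  exists (Num.min d b) => /=; first by rewrite lt_min d0.
  move=> u Ju; rewrite subr0 lt_min => /andP[ud ub].
  have := J0 u Ju; rewrite le_eqVlt => /predU1P[<-|u0].
    by rewrite subrr mulr0 subr0 normr0 mulr0.
  have := @taylor m F h 1 (Num.min d b) (F' 0 / m.+3%:R) e Jx _ dh (h0 Jx) (hl Jx)
    _ u Ju _ u0.
  rewrite expr1; apply.
  - by rewrite ge_min lexx orbT.
  - move=> v Jv; rewrite lt_min => /andP[vd vb].
    rewrite [m.+3%:R * _]mulrC divfK// expr1.
    by have := hd v Jv; rewrite subr0; exact.
  - by rewrite lt_min ud.
apply: (IH m.+2 F') => //.
- move=> u Ju u0; have un := lt0r_neq0 u0.
  rewrite {2}/h1 (negbTE un).
  have FhJ := within_derivD (FF' u Ju)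
    (within_derivM (within_deriv_cst J (- m.+1%:R) u) (dh u Ju u0)).
  have := within_derivM FhJ
    (within_derivM (within_deriv_cst J 2^-1 u) (within_derivV J un)).
  move=> /(within_deriv_near (G := h1) Ju) H.
  have := H _; rewrite /=; set L := (X in within_deriv _ _ _ X).
  have -> : L = (F' u - m.+3%:R * ((F u - m.+1%:R * h u) / (2 * u))) / (2 * u).
    rewrite /L -[m.+3]addn2 natrD; field.
    by rewrite un.
  apply; exists u => // y; rewrite /ball_ /= => yu Jy.
  have y0 : y != 0.
    apply/eqP => y0; move: yu; rewrite y0 subr0 gtr0_norm// ltxx //.
  rewrite /h1 (negbTE y0); field.
  by rewrite y0.
- by move=> J00; rewrite /h1 eqxx.
(* Growth condition for the derivative: [t ^+ m.+3 * h1 (t ^+ 2)] is half of [t ^+ m.+1 * F (t ^+ 2)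
   - m.+1 * t ^+ m.+1 * h (t ^+ 2)], and both terms tend to 0. *)
- move=> J00.
  have F0 : t ^+ m.+1 * F (t ^+ 2) @[t --> 0^'+] --> 0.
    rewrite -[X in _ --> X](mul0r (F 0)); apply: cvgM; first exact: exprn_cvg0.
    have := within_deriv_cvg (FF' _ J00) => /cvgrPdist_le H.
    apply/cvgrPdist_le => e e0; have [d /= d0 hd] := H e e0.
    near=> t; have t0 : 0 < t by [].
    have t1 : t < Num.min 1 (Num.min d b).
      by near: t; apply: nbhs_right_lt; rewrite !lt_min ltr01 d0.
    move: t1; rewrite !lt_min => /and3P[t1 td tb].
    have t2 : t ^+ 2 <= t by rewrite expr2 ler_piMr// ltW.
    apply: hd; first by rewrite /ball_ /= sub0r normrN ger0_norm ?sqr_ge0// (le_lt_trans t2).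
    by apply: (itvJ _ _ J00 Jb); rewrite sqr_ge0 ltW// (le_lt_trans t2).
  have : t ^+ m.+1 * F (t ^+ 2) / 2 + (- m.+1%:R / 2) * (t ^+ m.+1 * h (t ^+ 2))
      @[t --> 0^'+] --> (0 / 2 + (- m.+1%:R / 2) * 0 : R).
    apply: cvgD; first exact: cvgMl.
    by apply: cvgMr; exact: hl.
  rewrite mul0r mulr0 addr0; apply: cvg_trans; apply: near_eq_cvg.
  near=> t; have t0 : t != 0 by rewrite gt_eqF.
  rewrite /h1 expf_eq0/= (negbTE t0) -[m.+3]addn2 exprD.
  by field; rewrite t0.
Unshelve. all: by end_near. Qed.

End within_C.

(** * The coefficients cosh phi(sqrt u) and sinh phi(sqrt u) / sqrt u *)

Section hyperbolic_coefficients.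
Context {R : realType} (J : set R) (f phi : R -> R).
Hypothesis J_interval : nondegenerate_interval J.
Hypothesis J_ge0 : J `<=` [set s | 0 <= s].
Hypothesis f_smooth : smooth_within J f.
Hypothesis phi_primitive : primitive_within [set t : R | 0 <= t /\ J (t ^+ 2)]
  (fun t => 2 * derive_within J f (t ^+ 2)) phi.
Hypothesis phi_ratio : J 0 -> cvg (sinh (phi s) / s @[s --> 0^'+]).

Definition cosh_coef (u : R) : R := cosh (phi (Num.sqrt u)).
Definition sinh_coef (u : R) : R := sinh_ratio phi (Num.sqrt u).

Local Notation T := [set t : R | 0 <= t /\ J (t ^+ 2)].
Local Notation f' := (derive_within J f).

Lemma cosh2_sinh2 (x : R) : cosh x ^+ 2 - sinh x ^+ 2 = 1.
Proof.
rewrite /cosh /sinh expRN; field.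
by rewrite gt_eqF// expR_gt0.
Qed.

Lemma within_deriv_cosh D x : within_deriv D (@cosh R) x (sinh x).
Proof.
apply: is_derive_within_deriv.
have -> : @cosh R = 2^-1 *: (expR + (expR \o -%R)).
  by apply/funext => y; rewrite /cosh/= /GRing.scale/= mulrC.
by apply: is_derive_eq; rewrite /sinh /GRing.scale/=; ring.
Qed.

Lemma within_deriv_sinh D x : within_deriv D (@sinh R) x (cosh x).
Proof.
apply: is_derive_within_deriv.
have -> : @sinh R = 2^-1 *: (expR - (expR \o -%R)).
  by apply/funext => y; rewrite /sinh/= /GRing.scale/= mulrC.
by apply: is_derive_eq; rewrite /cosh /GRing.scale/=; ring.
Qed.

Arguments within_deriv_cosh D x : clear implicits.
Arguments within_deriv_sinh D x : clear implicits.

Lemma sqrt_within u : J u -> T (Num.sqrt u).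
Proof. by move=> Ju; split; rewrite ?sqrtr_ge0// sqr_sqrtr//; exact: J_ge0. Qed.

Lemma near0_within : J 0 -> \forall t \near 0^'+, T t.
Proof.
move: J_interval => [itv [a [b [Ja Jb ab]]]] J0.
have b0 : 0 < b by rewrite (le_lt_trans _ ab)//; exact: (J_ge0 Ja).
near=> t; have t0 : 0 < t by [].
have t1 : t < Num.min 1 b.
  by near: t; apply: nbhs_right_lt; rewrite !lt_min ltr01 b0.
move: t1; rewrite lt_min => /andP[t1 tb].
split; first exact: ltW.
apply: (itv _ _ J0 Jb); rewrite sqr_ge0/=.
by rewrite (le_trans _ (ltW tb))// expr2 ler_piMr// ltW.
Unshelve. all: by end_near. Qed.

(** [phi] is differentiated relative to [T], whereas [sinh_ratio] takes its value at 0 from a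
    right-hand limit; all small positive numbers lie in [T], which reconciles the two. *)
Lemma cvg_at_right0_within (F : set_system R) (g : R -> R) : J 0 ->
  g @ within T 0^' `=>` F -> g @ 0^'+ `=>` F.
Proof.
move=> J0 gF A /gF; rewrite /= /within/= !nbhs_simpl => gA.
have := near0_within J0; rewrite /at_right /within/= => T0.
apply: (@filterS2 _ (nbhs (0 : R)) _ _ _ _ _ gA T0) => t {}gA {}T0 t0.
by apply: gA; [rewrite gt_eqF|exact: T0].
Qed.

Lemma cvg_sinh_phi0 : J 0 -> sinh (phi s) @[s --> 0^'+] --> sinh (phi 0).
Proof.
move=> J0; have T0 : T 0 by rewrite /= expr0n.
apply: (cvg_at_right0_within (g := sinh \o phi)) => //.
have := within_deriv_cvg (within_deriv_comp T0 (fun _ _ => I)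
  (within_deriv_sinh setT (phi 0)) (phi_primitive T0)).
apply: cvg_trans; apply: cvg_app => A; rewrite /within/= => -[e e0 he].
by exists e => // y ye _; exact: he.
Qed.

(** This is how the hypothesis on the ratio normalises the primitive: a finite limit of
    [sinh (phi s) / s] forces the numerator to tend to 0. *)
Lemma sinh_phi0 : J 0 -> sinh (phi 0) = 0.
Proof.
move=> J0; have s1 := cvg_sinh_phi0 J0.
have s2 : sinh (phi s) @[s --> 0^'+] --> (0 : R).
  have id0 : (s : R) @[s --> 0^'+] --> (0 : R) by exact: cvg_within_filter cvg_id.
  rewrite -[X in _ --> X](mulr0 (lim (sinh (phi s) / s @[s --> 0^'+]))).
  apply: cvg_trans (cvgM (phi_ratio J0) id0); apply: near_eq_cvg.
  by near=> s; rewrite /= divfK// gt_eqF.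
exact: (cvg_unique _ s1 s2).
Unshelve. all: by end_near. Qed.

Lemma cosh_phi0 : J 0 -> cosh (phi 0) = 1.
Proof.
move=> J0; have := cosh2_sinh2 (phi 0); rewrite sinh_phi0// expr0n/= subr0.
move=> /eqP; rewrite sqrf_eq1 => /orP[/eqP//|/eqP c].
have : 0 < cosh (phi 0) by rewrite /cosh divr_gt0// addr_gt0// expR_gt0.
by rewrite c oppr_gt0 ltr10.
Qed.

(** Since [sinh (phi 0) = 0], the ratio is the difference quotient of [sinh \o phi] at 0. The result
    is exactly the initial value that the singular equation prescribes. *)
Lemma sinh_coef0 : J 0 -> sinh_coef 0 = 2 * f' 0.
Proof.
move=> J0; have T0 : T 0 by rewrite /= expr0n.
rewrite /sinh_coef sqrtr0 /sinh_ratio eqxx.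
have := within_deriv_comp T0 (fun _ _ => I)
    (within_deriv_sinh setT (phi 0)) (phi_primitive T0).
move=> /(cvg_at_right0_within J0) H; apply: (@cvg_lim R) => //.
move: H; rewrite cosh_phi0// mul1r expr0n/= sinh_phi0//; apply: cvg_trans.
apply: near_eq_cvg; near=> s; by rewrite !subr0.
Unshelve. all: by end_near. Qed.

Lemma mulr_sinh_coef t : 0 <= t -> J (t ^+ 2) -> t * sinh_coef (t ^+ 2) = sinh (phi t).
Proof.
move=> t0 Jt; rewrite /sinh_coef sqrtr_sqr ger0_norm// /sinh_ratio.
case: eqVneq => [t00|tn0]; last by rewrite mulrC divfK.
by move: Jt; rewrite t00 expr0n/= mul0r => /sinh_phi0.
Qed.

Lemma cosh_coef2 u : J u -> cosh_coef u ^+ 2 - u * sinh_coef u ^+ 2 = 1.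
Proof.
move=> Ju; have u0 : 0 <= u := J_ge0 Ju.
have := @mulr_sinh_coef (Num.sqrt u); rewrite sqr_sqrtr// sqrtr_ge0.
move=> /(_ erefl Ju) us; rewrite -{2}(sqr_sqrtr u0) -exprMn us.
exact: cosh2_sinh2.
Qed.

Lemma within_deriv_cosh_coef_gt0 u : J u -> 0 < u ->
  within_deriv J cosh_coef u (f' u * sinh_coef u).
Proof.
move=> Ju u0; have tu := sqr_sqrtr (ltW u0).
have t0 : 0 < Num.sqrt u by rewrite sqrtr_gt0.
have D1 := within_deriv_comp (sqrt_within Ju) (fun _ _ => I)
    (within_deriv_cosh setT _) (phi_primitive (sqrt_within Ju)).
have := within_deriv_comp Ju sqrt_within D1 (is_derive_within_deriv J (is_derive1_sqrt u0)).
congr within_deriv; rewrite tu.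
have := @mulr_sinh_coef (Num.sqrt u); rewrite tu => /(_ (ltW t0) Ju) <-.
by field; rewrite gt_eqF.
Qed.

Lemma within_deriv_sinh_coef u : J u -> 0 < u ->
  within_deriv J sinh_coef u ((2 * cosh_coef u * f' u - sinh_coef u) / (2 * u)).
Proof.
move=> Ju u0; have tu := sqr_sqrtr (ltW u0).
have t0 : 0 < Num.sqrt u by rewrite sqrtr_gt0.
have D1 := within_deriv_comp (sqrt_within Ju) (fun _ _ => I)
    (within_deriv_sinh setT _) (phi_primitive (sqrt_within Ju)).
have Ds := is_derive_within_deriv J (is_derive1_sqrt u0).
have D2 := within_deriv_comp Ju sqrt_within D1 Ds.
have tn0 : Num.sqrt u != 0 by rewrite gt_eqF.
have D3 := within_deriv_comp Ju (fun _ _ => I) (within_derivV setT tn0) Ds.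
have D4 := within_derivM D2 D3.
have ts := @mulr_sinh_coef (Num.sqrt u); rewrite tu in ts.
have {}ts := ts (ltW t0) Ju.
have NY : \forall y \near u, J y ->
    (sinh \o phi \o Num.sqrt) y * (GRing.inv \o Num.sqrt) y = sinh_coef y.
  exists u => // y; rewrite /ball_ /= => yu Jy.
  have y0 : 0 < y.
    rewrite lt_neqAle J_ge0// andbT; apply/eqP => y0; move: yu.
    by rewrite -y0 subr0 gtr0_norm// ltxx.
  have ty : 0 < Num.sqrt y by rewrite sqrtr_gt0.
  have := @mulr_sinh_coef (Num.sqrt y).
  rewrite (sqr_sqrtr (ltW y0)) => /(_ (ltW ty) Jy) /= <-.
  by rewrite mulrC mulKf// gt_eqF.
have := within_deriv_near Ju NY D4; congr within_deriv.
rewrite /= -ts /cosh_coef; move: (cosh _) (sinh_coef u) => c S.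
rewrite tu; move: (f' u) tu tn0 => g; move: (Num.sqrt u) => r <- r0.
by field; rewrite r0.
Qed.

Lemma cosh_coef_within_C0 : within_C 0 J cosh_coef.
Proof.
move=> u Ju; rewrite /cosh_coef.
have D1 := within_deriv_cvg (within_deriv_comp (sqrt_within Ju) (fun _ _ => I)
    (within_deriv_cosh setT _) (phi_primitive (sqrt_within Ju))).
apply: cvg_trans D1.
have D2 : Num.sqrt @ within J (nbhs u) `=>` within T (nbhs (Num.sqrt u)).
  move=> A; rewrite /within/= !nbhs_simpl => TA.
  have := @sqrt_continuous R u _ TA; rewrite /= !nbhs_simpl.
  move=> H; apply: (@filterS _ (nbhs u) _ _ _ _ H) => y TA' Jy.
  by apply: TA'; exact: sqrt_within.
by move=> A /D2.
Qed.

Lemma interval_pos : exists2 b, J b & 0 < b.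
Proof.
case: J_interval => _ [a [b [Ja Jb ab]]]; exists b => //.
by rewrite (le_lt_trans _ ab)//; exact: J_ge0 Ja.
Qed.

Local Notation F := (fun u => 2 * cosh_coef u * f' u).

Lemma cosh_coef_F n : within_C n J cosh_coef -> within_C n J F.
Proof.
move=> Cc; apply: within_CM; first by apply: within_CM => //; exact: within_C_cst.
exact: (@smooth_within_C _ n 1 J f f_smooth).
Qed.

(** The coefficient solves the singular equation with [m = 0] and right-hand side [2 C f']. Its
    growth condition at 0 holds because [t * sinh_coef (t ^+ 2)] is [sinh (phi t)], which tends to
    0. *)
Lemma sinh_coef_within_C n : within_C n J cosh_coef -> within_C n J sinh_coef.
Proof.
have [b Jb b0] := interval_pos.
move=> /cosh_coef_F CF; apply: (@singular_ode_within_C _ n 0 J F sinh_coef b) => //.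
- by case: J_interval.
- move=> u Ju u0; rewrite mul1r; exact: within_deriv_sinh_coef.
- by move=> J0; rewrite divr1 sinh_coef0// /cosh_coef sqrtr0 cosh_phi0// mulr1.
- move=> J0; have T0 : T 0 by rewrite /= expr0n.
  have D : t * sinh_coef (t ^+ 2) @[t --> 0^'+] --> sinh (phi 0).
    have : sinh (phi s) @[s --> 0^'+] --> sinh (phi 0) by exact: cvg_sinh_phi0.
    apply: cvg_trans; apply: near_eq_cvg.
    near=> t; have t0 : 0 < t by [].
    have [_ Jt] : T t by near: t; exact: near0_within.
    by rewrite mulr_sinh_coef// ltW.
  by rewrite sinh_phi0 in D.
Unshelve. all: by end_near. Qed.

Lemma cosh_coef0 : J 0 -> cosh_coef 0 = 1.
Proof. by move=> J0; rewrite /cosh_coef sqrtr0 cosh_phi0. Qed.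

(** The chain rule through the square root fails at 0. There the relation [C ^+ 2 - u * s ^+ 2 = 1]
    turns the difference quotient [(C - 1) / u] into [s ^+ 2 / (C + 1)], whose limit only needs
    continuity of both coefficients. *)
Lemma within_deriv_cosh_coef u : J u -> within_deriv J cosh_coef u (f' u * sinh_coef u).
Proof.
move=> Ju; have := J_ge0 Ju; rewrite /= le_eqVlt => /predU1P[u0|u0]; last first.
  exact: within_deriv_cosh_coef_gt0.
rewrite -{}u0 in Ju *.
have cS := @sinh_coef_within_C 0 cosh_coef_within_C0 _ Ju.
have cC := cosh_coef_within_C0 Ju.
have c1 x : J x -> cosh_coef x + 1 != 0.
  by move=> _; rewrite gt_eqF// /cosh_coef /cosh addr_gt0// divr_gt0// addr_gt0// expR_gt0.
have : sinh_coef x ^+ 2 / (cosh_coef x + 1) @[x --> within J (nbhs 0)] -->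
    sinh_coef 0 ^+ 2 / (cosh_coef 0 + 1).
  apply: cvgM; first exact: cvgM.
  apply: cvgV; first exact: c1.
  by apply: cvgD => //; exact: cvg_cst.
have -> : sinh_coef 0 ^+ 2 / (cosh_coef 0 + 1) = f' 0 * sinh_coef 0.
  by rewrite cosh_coef0// sinh_coef0//; field.
move=> H A /H [e e0 he]; exists e => // y ye y0 Jy.
rewrite /= subr0 cosh_coef0// (_ : (_ - 1) / y = sinh_coef y ^+ 2 / (cosh_coef y + 1)).
  exact: he.
have := cosh_coef2 Jy => E; have := c1 y Jy => cy.
have -> : sinh_coef y ^+ 2 = (cosh_coef y ^+ 2 - 1) / y by rewrite -E; field.
by field; rewrite cy y0.
Qed.

(** Bootstrap: if [C] is of class n then so is [s], by the singular equation, hence so is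
    [C' = f' s], and [C] is of class n + 1. *)
Lemma cosh_coef_within_C n : within_C n J cosh_coef.
Proof.
elim: n => [|n IH]; first exact: cosh_coef_within_C0.
exists (fun u => f' u * sinh_coef u); first exact: within_deriv_cosh_coef.
apply: within_CM; last exact: sinh_coef_within_C.
exact: (@smooth_within_C _ n 1 J f f_smooth).
Qed.

Lemma sinh_coef_derive : exists2 S' : R -> R,
  forall u, J u -> within_deriv J sinh_coef u (S' u) &
  forall u, J u -> 2 * u * S' u + sinh_coef u = 2 * cosh_coef u * f' u.
Proof.
have [S' SS' _] := @sinh_coef_within_C 1 (@cosh_coef_within_C 1).
(* Away from 0 the explicit formula satisfies the equation by construction. At 0 the factor [2 u]
   removes the derivative from the equation, so any derivative there will do. *)
exists (fun u => if u == 0 then S' u else (F u - sinh_coef u) / (2 * u)).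
  move=> u Ju; case: eqVneq => [_|u0]; first exact: SS'.
  by apply: within_deriv_sinh_coef; rewrite // lt_neqAle eq_sym u0; exact: J_ge0.
move=> u Ju; case: eqVneq => [u0|u0]; last by field.
rewrite u0 in Ju *; rewrite sinh_coef0// cosh_coef0//; ring.
Qed.

End hyperbolic_coefficients.

(** * Two by two matrices *)

Section matrices2.

Lemma ord2P (P : 'I_2 -> Prop) : P 0 -> P 1 -> forall i, P i.
Proof.
move=> P0 P1 i; have [->//|i0] := eqVneq i 0; rewrite (_ : i = 1)//.
by apply/val_inj; move: i i0 => [[|[|//]] ?].
Qed.

Lemma sum_ord2 (V : nmodType) (F : 'I_2 -> V) : \sum_i F i = F 0 + F 1.
Proof. by rewrite big_ord_recl big_ord1; congr (_ + F _); exact/val_inj. Qed.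

Lemma mx2P (T : Type) (A B : 'M[T]_2) :
  A 0 0 = B 0 0 -> A 0 1 = B 0 1 -> A 1 0 = B 1 0 -> A 1 1 = B 1 1 -> A = B.
Proof.
by move=> *; apply/matrixP; apply: ord2P; apply: ord2P.
Qed.

Lemma mulmx2E (R : pzSemiRingType) m n (A : 'M[R]_(m, 2)) (B : 'M[R]_(2, n)) i j :
  (A *m B) i j = A i 0 * B 0 j + A i 1 * B 1 j.
Proof. by rewrite mxE sum_ord2. Qed.

Lemma mxtrace2 (R : nmodType) (A : 'M[R]_2) : \tr A = A 0 0 + A 1 1.
Proof. by rewrite /mxtrace sum_ord2. Qed.

Lemma det2 (R : comPzRingType) (A : 'M[R]_2) :
  \det A = A 0 0 * A 1 1 - A 0 1 * A 1 0.
Proof.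
rewrite (expand_det_row _ 0) sum_ord2 /cofactor !det_mx11 !mxE/=.
have l0 : lift 0 0 = 1 :> 'I_2 by exact/val_inj.
have l1 : lift 1 0 = 0 :> 'I_2 by exact/val_inj.
by rewrite l0 l1 expr0 expr1 mul1r mulN1r mulrN.
Qed.

Lemma invmx2 (F : fieldType) (A : 'M[F]_2) : \det A != 0 ->
  [/\ invmx A 0 0 = A 1 1 / \det A, invmx A 0 1 = - A 0 1 / \det A,
      invmx A 1 0 = - A 1 0 / \det A & invmx A 1 1 = A 0 0 / \det A].
Proof.
move=> A0; pose B : 'M[F]_2 := \matrix_(i, j)
  (if i == 0 then if j == 0 then A 1 1 / \det A else - A 0 1 / \det A
   else if j == 0 then - A 1 0 / \det A else A 0 0 / \det A).
have uA : A \in unitmx by rewrite unitmxE unitfE.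
have AB : A *m B = 1%:M.
  by apply: mx2P; rewrite mulmx2E !mxE/=; move: A0; rewrite det2 => A0; field.
have -> : invmx A = B by rewrite -[LHS]mulmx1 -AB mulmxA mulVmx// mul1mx.
by rewrite !mxE.
Qed.

End matrices2.

(** * Smooth functions on open subsets of the plane *)

Section differentiability.
Context {R : realType}.

Lemma differentiable_bound (V W : normedModType R) (f : V -> W) (x : V) :
  differentiable f x -> forall e : R, 0 < e ->
  \forall h \near 0, `|f (h + x) - f x - 'd f x h| <= e * `|h|.
Proof.
by move=> /diff_locallyP[_ /eqaddoP H] e /H; apply: filterS => h; rewrite opprD addrA.
Qed.

Lemma bound_differentiable (V W : normedModType R) (f : V -> W)
    (df : {linear V -> W}) (x : V) : continuous df ->
  (forall e : R, 0 < e ->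
    \forall h \near 0, `|f (h + x) - f x - df h| <= e * `|h|) ->
  differentiable f x /\ 'd f x = df :> (V -> W).
Proof.
move=> cdf H.
have E : f \o shift x = cst (f x) + df +o_ 0 id.
  by apply/eqaddoP => e /H; apply: filterS => h; rewrite opprD addrA.
have D := diff_unique cdf E; split=> //; apply/diff_locallyP; rewrite D; split=> //.
Qed.

Lemma near0_shift (V : normedModType R) (P : set V) (x : V) :
  (\forall y \near x, P y) -> \forall h \near 0, P (h + x).
Proof. by rewrite (near_shift 0 x) /= subr0. Qed.

Lemma near_eq_differentiable (V W : normedModType R) (f g : V -> W) (x : V) :
  {near x, f =1 g} -> differentiable f x -> differentiable g x.
Proof.
move=> fg df; apply: (proj1 (@bound_differentiable V W g ('d f x) x
  (diff_continuous df) _)) => e e0.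
have := differentiable_bound df e0; apply: filterS2 (near0_shift fg) => h -> .
by rewrite (nbhs_singleton fg).
Qed.

(** The outer function is differentiable only relative to [J], and [w x] may be an endpoint of [J],
    as at an umbilic where [w] is [H^2 - K]. It suffices that [w] sends a full neighbourhood of [x]
    into [J]. *)
Lemma differentiable_within_comp (V : normedModType R) (J : set R)
    (F : R -> R) (w : V -> R^o) (x : V) (L : R) :
  (\forall y \near x, J (w y)) -> differentiable w x ->
  within_deriv J F (w x) L ->
  differentiable (F \o w : V -> R^o) x /\
  'd (F \o w : V -> R^o) x = (fun v => L * 'd w x v) :> (V -> R^o).
Proof.
move=> Jw dw /within_derivP FL.
apply: (@bound_differentiable V R^o (F \o w) (L \*: 'd w x) x).
  by move=> v; apply: continuousZl_tmp; exact: (diff_continuous dw).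
move=> e e0.
have [k k0 dwk] := linear_lipschitz (diff_continuous dw).
have L0 : 0 < 1 + `|L| by rewrite ltr_pwDl.
have k1 : 0 < k + 1 by rewrite addr_gt0.
have [d d0 hd] := FL (e / 2 / (k + 1)) (divr_gt0 (divr_gt0 e0 (ltr0Sn _ _)) k1).
have wd : \forall h \near 0, `|w (h + x) - w x| < d.
  have /cvgrPdist_lt/(_ d d0) := differentiable_continuous dw.
  by move=> /near0_shift; apply: filterS => h /=; rewrite distrC.
have Jw0 : \forall h \near 0, J (w (h + x)) by exact: near0_shift Jw.
have e2 : 0 < Num.min 1 (e / 2 / (1 + `|L|)).
  by rewrite lt_min ltr01 !divr_gt0.
near=> h.
have wh : `|w (h + x) - w x - 'd w x h| <= Num.min 1 (e / 2 / (1 + `|L|)) * `|h|.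
  by near: h; exact: differentiable_bound.
have wkh : `|w (h + x) - w x| <= (k + 1) * `|h|.
  rewrite -[w (h + x) - w x](subrK ('d w x h)) (le_trans (ler_normD _ _))//.
  rewrite addrC mulrDl lerD// (le_trans wh)// ler_wpM2r//.
  by rewrite ge_min lexx.
have -> : (F \o w) (h + x) - (F \o w) x - (L \*: 'd w x) h =
   (F (w (h + x)) - F (w x) - L * (w (h + x) - w x)) +
   L * (w (h + x) - w x - 'd w x h).
  by rewrite /= /GRing.scale/=; ring.
rewrite (le_trans (ler_normD _ _))// (splitr e) mulrDl lerD//.
  apply: (@le_trans _ _ (e / 2 / (k + 1) * ((k + 1) * `|h|))).
    apply: (le_trans (hd _ _ _)) => //.
    - by near: h.
    - by near: h.
    - by rewrite ler_wpM2l// !divr_ge0// ltW.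
  by rewrite mulrA divfK ?gt_eqF.
rewrite normrM; apply: (@le_trans _ _ (`|L| * (e / 2 / (1 + `|L|) * `|h|))).
  rewrite ler_wpM2l// (le_trans wh)// ler_wpM2r//.
  by rewrite ge_min lexx orbT.
rewrite mulrA ler_wpM2r// mulrA ler_pdivrMr// mulrC ler_wpM2l//.
  by rewrite divr_ge0 ?ltW.
by rewrite lerDr.
Unshelve. all: by end_near. Qed.

End differentiability.

Section class_C_theory.
Context {R : realType}.
Implicit Types (W : set 'rV[R]_2) (V : normedModType R).

Lemma open_near W x (P : set 'rV[R]_2) : open W -> W x -> W `<=` P ->
  \forall y \near x, P y.
Proof. by move=> oW Wx WP; apply: (@filterS _ (nbhs x) _ _ _ WP); exact: open_nbhs_nbhs. Qed.

Lemma class_C_ext V n W (F G : 'rV[R]_2 -> V) : open W ->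
  (forall x, W x -> F x = G x) -> class_C n W F -> class_C n W G.
Proof.
move=> oW; elim: n F G => [|n IH] F G FG /=.
  move=> cF x Wx; rewrite /prop_for /continuous_at -FG//.
  apply: cvg_trans (cF x Wx); apply: (@near_eq_cvg _ _ (nbhs x)).
  have nFG : \forall y \near x, F y = G y by exact: open_near FG.
  exact: nFG.
move=> [dF CF]; split=> [x Wx|j].
  apply: near_eq_differentiable (dF x Wx).
  have nFG : \forall y \near x, F y = G y by exact: open_near FG.
  exact: nFG.
apply: IH (CF j) => x Wx.
have nFG : \forall y \near x, F y = G y by exact: open_near FG.
exact: near_eq_derive.
Qed.

Lemma class_CW V n W (F : 'rV[R]_2 -> V) : class_C n.+1 W F -> class_C n W F.
Proof.
elim: n F => [F [dF _] x Wx|n IH F [dF CF]].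
  exact: differentiable_continuous (dF x Wx).
by split=> // j; exact: IH (CF j).
Qed.

Lemma class_C_near V n W (F : 'rV[R]_2 -> V) :
  (forall x, W x -> exists2 U, U x & class_C n U F) -> class_C n W F.
Proof.
elim: n F => [F CF x Wx|n IH F CF /=]; first by have [U Ux] := CF x Wx; exact.
split=> [x Wx|j]; first by have [U Ux [dF _]] := CF x Wx; exact: dF.
by apply: IH => x Wx; have [U Ux [_ CF']] := CF x Wx; exists U; last exact: CF'.
Qed.

Lemma class_C_cst V n W (c : V) : class_C n W (cst c).
Proof.
elim: n c => [c x Wx|n IH c]; first exact: cst_continuous.
split=> [x Wx|j]; first exact: differentiable_cst.
have -> : 'D_('e_j) (cst c) = cst 0 :> ('rV[R]_2 -> V).
  by apply/funext => x; rewrite derive_cst.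
exact: IH.
Qed.

Lemma class_CD V n W (F G : 'rV[R]_2 -> V) : open W ->
  class_C n W F -> class_C n W G -> class_C n W (fun x => F x + G x).
Proof.
move=> oW; elim: n F G => [F G CF CG x Wx|n IH F G [dF CF] [dG CG]].
  by apply: continuousD; [exact: CF|exact: CG].
split=> [x Wx|j].
  by apply: differentiableD; [exact: dF|exact: dG].
apply: class_C_ext (IH _ _ (CF j) (CG j)) => // x Wx.
by rewrite -deriveD//; apply: diff_derivable; [exact: dF|exact: dG].
Qed.

Lemma class_CM n W (F G : 'rV[R]_2 -> R^o) : open W ->
  class_C n W F -> class_C n W G -> class_C n W (fun x => F x * G x : R^o).
Proof.
move=> oW; elim: n F G => [F G CF CG x Wx|n IH F G CF CG].
  by apply: (@continuousM R _ F G x); [exact: CF|exact: CG].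
have [[dF CF'] [dG CG']] := (CF, CG).
split=> [x Wx|j].
  by apply: (@differentiableM R _ F G); [exact: dF|exact: dG].
apply: (@class_C_ext _ _ _ (fun x => F x * 'D_('e_j) G x + G x * 'D_('e_j) F x)) => //.
  move=> x Wx; rewrite -[RHS]/('D_('e_j) (F * G) x) (@deriveM R)//.
    by apply: diff_derivable; exact: dF.
  by apply: diff_derivable; exact: dG.
by apply: class_CD => //; apply: IH;
  [exact: class_CW CF|exact: CG'|exact: class_CW CG|exact: CF'].
Qed.

Lemma class_C_comp n W (J : set R) (F : R -> R) (w : 'rV[R]_2 -> R^o) : open W ->
  (forall x, W x -> J (w x)) -> within_C n J F -> class_C n W w ->
  class_C n W (F \o w : 'rV[R]_2 -> R^o).
Proof.
move=> oW Jw; elim: n F => [F CF Cw x Wx|n IH F [F' FF' CF'] Cw].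
  move=> A /(CF _ (Jw _ Wx)) FA.
  have wA := Cw _ Wx _ FA.
  have nJ : \forall y \near x, J (w y) by exact: open_near Jw.
  by apply: (@filterS2 _ (nbhs x) _ _ _ _ _ wA nJ) => y {}wA {}nJ; exact: wA.
have [dw Cw'] := Cw.
split=> [x Wx|j].
  have nJ : \forall y \near x, J (w y) by exact: open_near Jw.
  exact: (differentiable_within_comp nJ (dw x Wx) (FF' _ (Jw _ Wx))).1.
apply: (@class_C_ext _ _ _ (fun x => F' (w x) * 'D_('e_j) w x)) => //.
  move=> x Wx.
  have nJ : \forall y \near x, J (w y) by exact: open_near Jw.
  have [dFw Fw] := differentiable_within_comp nJ (dw x Wx) (FF' _ (Jw _ Wx)).
  by rewrite (deriveE _ dFw) Fw (deriveE _ (dw x Wx)).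
apply: class_CM => //; last exact: Cw'.
exact: (IH F' CF' (class_CW Cw)).
Qed.

End class_C_theory.

Section smooth_on_theory.
Context {R : realType}.
Implicit Types (W : set 'rV[R]_2) (V : normedModType R).

(** Real powers form a family stable under differentiation; the exponents -1 and 1/2 give inverses
    and square roots of positive smooth functions. *)
Lemma within_C_powR n (a : R) : within_C n [set x : R | 0 < x] (fun x => x `^ a).
Proof.
elim: n a => [|n IH] a.
  move=> x x0; apply: within_deriv_cvg.
  exact: is_derive_within_deriv (is_derive1_powR a x0).
exists (fun x => a * x `^ (a - 1)).
  by move=> x x0; exact: is_derive_within_deriv (is_derive1_powR a x0).
by apply: within_CM => //; exact: within_C_cst.
Qed.

Lemma smooth_on_ext V W (F G : 'rV[R]_2 -> V) : open W ->
  (forall x, W x -> F x = G x) -> smooth_on W F -> smooth_on W G.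
Proof. by move=> oW FG sF n; exact: class_C_ext (sF n). Qed.

Lemma smooth_on_near V W (F : 'rV[R]_2 -> V) :
  (forall x, W x -> exists2 U, U x & smooth_on U F) -> smooth_on W F.
Proof.
move=> sF n; apply: class_C_near => x Wx; have [U Ux sU] := sF x Wx.
by exists U.
Qed.

Lemma smooth_on_cst V W (c : V) : smooth_on W (cst c).
Proof. by move=> n; exact: class_C_cst. Qed.

Lemma smooth_onD V W (F G : 'rV[R]_2 -> V) : open W ->
  smooth_on W F -> smooth_on W G -> smooth_on W (fun x => F x + G x).
Proof. by move=> oW sF sG n; exact: class_CD. Qed.

Lemma smooth_onM W (F G : 'rV[R]_2 -> R^o) : open W ->
  smooth_on W F -> smooth_on W G -> smooth_on W (fun x => F x * G x : R^o).
Proof. by move=> oW sF sG n; exact: class_CM. Qed.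

Lemma smooth_onN W (F : 'rV[R]_2 -> R^o) : open W ->
  smooth_on W F -> smooth_on W (fun x => - F x : R^o).
Proof.
move=> oW sF; apply: (@smooth_on_ext _ _ (fun x => (- 1 : R^o) * F x)) => //.
  by move=> x _; rewrite mulN1r.
by apply: smooth_onM => //; exact: smooth_on_cst.
Qed.

Lemma smooth_onB W (F G : 'rV[R]_2 -> R^o) : open W ->
  smooth_on W F -> smooth_on W G -> smooth_on W (fun x => F x - G x : R^o).
Proof. by move=> oW sF sG; apply: smooth_onD => //; exact: smooth_onN. Qed.

Lemma smooth_on_comp W (J : set R) (F : R -> R) (w : 'rV[R]_2 -> R^o) : open W ->
  (forall x, W x -> J (w x)) -> (forall n, within_C n J F) -> smooth_on W w ->
  smooth_on W (F \o w : 'rV[R]_2 -> R^o).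
Proof. by move=> oW Jw CF sw n; exact: (class_C_comp oW Jw (CF n) (sw n)). Qed.

Lemma smooth_onV W (w : 'rV[R]_2 -> R^o) : open W -> (forall x, W x -> 0 < w x) ->
  smooth_on W w -> smooth_on W (fun x => (w x)^-1 : R^o).
Proof.
move=> oW w0 sw.
apply: smooth_on_ext (smooth_on_comp oW w0 (within_C_powR ^~ (-1)) sw) => // x Wx.
by rewrite /= powR_inv1// ltW// w0.
Qed.

Lemma smooth_on_sqrt W (w : 'rV[R]_2 -> R^o) : open W -> (forall x, W x -> 0 < w x) ->
  smooth_on W w -> smooth_on W (fun x => Num.sqrt (w x) : R^o).
Proof.
move=> oW w0 sw.
apply: smooth_on_ext (smooth_on_comp oW w0 (within_C_powR ^~ 2^-1) sw) => // x Wx.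
by rewrite /= powR12_sqrt// ltW// w0.
Qed.

Lemma derive_coord n (F : 'rV[R]_2 -> 'rV[R]_n) x v j : differentiable F x ->
  'D_v (fun y => F y 0 j : R^o) x = 'D_v F x 0 j.
Proof. by move=> dF; rewrite derive_mx ?mxE//; exact: diff_derivable. Qed.

Lemma class_C_coord n W (F : 'rV[R]_2 -> 'rV[R]_2) j : open W ->
  class_C n W F -> class_C n W (fun x => F x 0 j : R^o).
Proof.
move=> oW; elim: n F => [F CF x Wx|n IH F [dF CF]].
  by apply: (@continuous_comp _ _ _ F (fun v : 'rV[R]_2 => v 0 j : R^o));
    [exact: CF|exact: coord_continuous].
split=> [x Wx|i].
  apply: (@differentiable_comp _ _ _ _ F (fun v : 'rV[R]_2 => v 0 j : R^o)); first exact: dF.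
  exact: differentiable_coord.
apply: class_C_ext (IH _ (CF i)) => // x Wx.
by rewrite derive_coord//; exact: dF.
Qed.

Lemma class_CZl V n W (k : 'rV[R]_2 -> R^o) (v : V) : open W ->
  class_C n W k -> class_C n W (fun x => k x *: v).
Proof.
move=> oW; elim: n k => [k Ck x Wx|n IH k [dk Ck]].
  by apply: (@continuousZr_tmp _ _ _ k v x); exact: Ck.
split=> [x Wx|i]; first by apply: differentiableZl; exact: dk.
apply: class_C_ext (IH _ (Ck i)) => // x Wx.
have dkv := @differentiableZl _ _ _ k v x (dk x Wx).
by rewrite (deriveE _ (dk x Wx)) (deriveE _ dkv) (@diffZl _ _ _ k v x (dk x Wx)).
Qed.

Lemma smooth_on_coord W (F : 'rV[R]_2 -> 'rV[R]_2) : open W ->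
  smooth_on W F <-> forall j, smooth_on W (fun x => F x 0 j : R^o).
Proof.
move=> oW; split=> [sF j n|sF n]; first exact: class_C_coord.
apply: (@class_C_ext _ _ _ _ (fun x => F x 0 0 *: 'e_0 + F x 0 1 *: 'e_1)) => //.
  move=> x _; apply/rowP => j; rewrite !mxE/=.
  case: (unliftP 0 j) => [i ->|->]; rewrite ?(ord1 i); last first.
    by rewrite !eqxx/= mulr1 mulr0 addr0.
  by rewrite (_ : lift 0 0 = 1)//= ?mulr0 ?mulr1 ?add0r//; exact/val_inj.
by apply: class_CD => //; apply: class_CZl => //; exact: sF.
Qed.

Lemma jacobianE (F : 'rV[R]_2 -> 'rV[R]_2) x i j : differentiable F x ->
  'J F x i j = 'D_('e_i) (fun y => F y 0 j : R^o) x.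
Proof. by move=> dF; rewrite derive_coord// deriveE// /jacobian /lin1_mx mxE. Qed.

Lemma smooth_on_jacobian W (F : 'rV[R]_2 -> 'rV[R]_2) i j : open W ->
  smooth_on W F -> smooth_on W (fun x => 'J F x i j : R^o).
Proof.
move=> oW sF; have sFj := (smooth_on_coord F oW).1 sF j.
apply: (@smooth_on_ext _ _ ('D_('e_i) (fun y => F y 0 j : R^o))) => //.
  by move=> x Wx; rewrite jacobianE//; have [dF _] := sF 1; exact: dF.
by move=> n; have [_] := sFj n.+1; exact.
Qed.

Lemma smooth_on_differentiable V W (F : 'rV[R]_2 -> V) x :
  smooth_on W F -> W x -> differentiable F x.
Proof. by move=> sF Wx; have [dF _] := sF 1; exact: dF. Qed.

End smooth_on_theory.

(** * Bump vector fields on a surface *)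

Section flat_functions.
Context {R : realType}.

(* The case [k = 0] is a smooth function vanishing exactly on the nonpositive
   reals; the other exponents make the family stable under derivation. *)
Definition flat (k : nat) (s : R) : R :=
  if s <= 0 then 0 else s^-1 ^+ k * expR (- s^-1).

Lemma flat_le0 k s : s <= 0 -> flat k s = 0.
Proof. by rewrite /flat => ->. Qed.

Lemma flat_gt0 k s : 0 < s -> 0 < flat k s.
Proof.
by move=> s0; rewrite /flat (leNgt s 0) s0/= mulr_gt0 ?expR_gt0// exprn_gt0// invr_gt0.
Qed.

(** The exponential dominates [x ^+ k.+2 / (k.+2)!] at [x = s^-1]. A quadratic bound is enough for
    the difference quotient at 0 to vanish. *)
Lemma flat_bound k s : 0 < s -> flat k s <= (k.+2)`!%:R * s ^+ 2.
Proof.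
move=> s0; rewrite /flat (leNgt s 0) s0/=.
have s1 : 0 <= s^-1 by rewrite invr_ge0 ltW.
have := expR_ge1Dxn k.+1 s1.
move=> /(le_trans _) => /(_ (s^-1 ^+ k.+2 / (k.+2)`!%:R)); rewrite lerDr ler01.
move=> /(_ erefl) H.
have f0 : 0 < (k.+2)`!%:R :> R by rewrite ltr0n fact_gt0.
rewrite expRN ler_pdivrMr ?expR_gt0//.
apply: (@le_trans _ _ ((k.+2)`!%:R * s ^+ 2 * (s^-1 ^+ k.+2 / (k.+2)`!%:R))).
  rewrite -[k.+2]addn2 (exprD _ k 2) le_eqVlt; apply/orP; left; apply/eqP.
  by rewrite addn2; field; rewrite gt_eqF//= gt_eqF.
by rewrite ler_wpM2l// mulr_ge0// ?sqr_ge0// ltW.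
Qed.

Lemma within_deriv_flat k s :
  within_deriv setT (flat k) s (flat k.+2 s - k%:R * flat k.+1 s).
Proof.
have [s0|s0|s0] := ltgtP s 0.
- rewrite !flat_le0 ?ltW// mulr0 subr0.
  apply: within_deriv_near (within_deriv_cst setT 0 s) => //.
  exists (- s) => [|y]; first by rewrite /= oppr_gt0.
  by rewrite /ball_ /= ltr_norml => /andP[ys _] _; rewrite flat_le0//; lra.
- have sn : s != 0 by rewrite gt_eqF.
  have DV := within_derivV setT sn.
  have DX : within_deriv setT (fun y => y^-1 ^+ k) s (- k%:R * s^-1 ^+ k.+1).
    case: k => [|k]; first by rewrite oppr0 mul0r; exact: within_deriv_cst.
    have := @within_deriv_comp _ setT setT (fun y => y ^+ k.+1) GRing.inv s _ _ I
      (fun _ _ => I) (within_derivX setT k s^-1) DV.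
    congr within_deriv; rewrite -[k.+2]addn2 exprD !exprVn.
    by field; rewrite ?expf_neq0 ?sn.
  have DE := @within_deriv_comp _ setT setT expR (fun y => cst (-1) y * y^-1) s _ _ I
    (fun _ _ => I) (is_derive_within_deriv setT (is_derive_expR _))
    (within_derivM (within_deriv_cst setT (-1) s) DV).
  have ND : \forall y \near s, setT y ->
      y^-1 ^+ k * (expR \o (fun y => cst (-1) y * y^-1)) y = flat k y.
    exists s => // y; rewrite /ball_ /= ltr_norml => /andP[_ ys] _.
    have y0 : 0 < y by lra.
    by rewrite /flat (leNgt y 0) y0/= mulN1r.
  have := within_deriv_near I ND (within_derivM DX DE).
  congr within_deriv; rewrite /flat (leNgt s 0) s0/= mulN1r -[k.+2]addn2 exprD exprS.
  by field; rewrite sn.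
- apply/within_derivP => e e0; rewrite s0 !flat_le0// mulr0 subr0.
  exists (e / (k.+2)`!%:R); first by rewrite divr_gt0// ltr0n fact_gt0.
  move=> y _; rewrite !subr0 mul0r subr0 => ye.
  have [y0|y0] := leP y 0; first by rewrite flat_le0// normr0 mulr_ge0// ltW.
  rewrite !ger0_norm ?(ltW y0) ?(ltW (flat_gt0 _ y0))//.
  rewrite (le_trans (flat_bound _ y0))// expr2 mulrA ler_wpM2r ?(ltW y0)//.
  by rewrite mulrC -ler_pdivlMr ?ltr0n ?fact_gt0// ltW// -(ger0_norm (ltW y0)).
Qed.

Arguments within_deriv_flat : clear implicits.

Lemma within_C_flat n k : within_C n setT (flat k).
Proof.
elim: n k => [|n IH] k.
  by move=> s Ts; exact: within_deriv_cvg (within_deriv_flat k s).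
exists (fun s => flat k.+2 s + (- k%:R) * flat k.+1 s).
  by move=> s _; rewrite mulNr; exact: within_deriv_flat.
by apply: within_CD => //; apply: within_CM => //; exact: within_C_cst.
Qed.

End flat_functions.

(** * Transition maps of charts and their Jacobians *)

Section charts_theory.
Context {R : realType} {M : topologicalType}.
Implicit Types (c d : chart R M).

Lemma cinvK c x : cimg c x -> cmap c (cinv c x) = x /\ cdom c (cinv c x).
Proof. by move=> [p cp <-]; rewrite cmapK. Qed.

Lemma overlapP c d x : overlap c d x <-> cimg c x /\ cdom d (cinv c x).
Proof.
split=> [[p [cp dp] <-]|[cx dx]]; first by rewrite cmapK//; split=> //; exists p.
by have [xx cc] := cinvK cx; exists (cinv c x).
Qed.

Lemma overlap_img c d x : overlap c d x -> cimg c x.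
Proof. by move=> /overlapP[]. Qed.

Lemma overlap_transition c d x : overlap c d x -> overlap d c (transition c d x).
Proof.
move=> [p [cp dp] <-]; rewrite /transition/= cmapK//.
by exists p.
Qed.

Lemma cinv_transition c d x : overlap c d x -> cinv d (transition c d x) = cinv c x.
Proof. by move=> [p [cp dp] <-]; rewrite /transition/= !cmapK. Qed.

Lemma transitionK c d x : overlap c d x -> transition d c (transition c d x) = x.
Proof. by move=> [p [cp dp] <-]; rewrite /transition/= !cmapK. Qed.

Lemma transition_comp c d e x : cimg c x -> cdom d (cinv c x) ->
  transition d e (transition c d x) = transition c e x.
Proof. by move=> cx dx; rewrite /transition/= cmapK. Qed.

Lemma cinv_continuous_at c x : cimg c x -> {for x, continuous (cinv c)}.
Proof.
move=> cx; have := cinv_continuous (c := c) => /subspace_continuousP/(_ x cx).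
move=> H A /H; rewrite /within/= => Hn.
have nc : \forall y \near x, cimg c y by exact: (open_near (@cimg_open _ _ c) cx).
by apply: (@filterS2 _ (nbhs x) _ _ _ _ _ Hn nc) => y {}Hn {}nc; exact: Hn.
Qed.

Lemma overlap_preimage_open c (U : set M) : open U ->
  open [set x | cimg c x /\ U (cinv c x)].
Proof.
move=> oU; rewrite openE => x [cx Ux].
have nc : \forall y \near x, cimg c y by exact: (open_near (@cimg_open _ _ c) cx).
have nU : \forall y \near x, U (cinv c y).
  exact: (cinv_continuous_at cx (open_nbhs_nbhs (conj oU Ux))).
exact: (@filterS2 _ (nbhs x) _ _ _ _ _ nc nU).
Qed.

Lemma overlap_open c d : open (overlap c d).
Proof.
rewrite (_ : overlap c d = [set x | cimg c x /\ cdom d (cinv c x)]).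
  exact: overlap_preimage_open (@cdom_open _ _ d).
by apply/seteqP; split=> x /overlapP.
Qed.

End charts_theory.
Arguments overlap_open {R M} c d.

Section jacobians.
Context {R : realType}.

Lemma eq_mulmx_row (A B : 'M[R]_2) : (forall v : 'rV_2, v *m A = v *m B) -> A = B.
Proof. by move=> AB; apply/row_matrixP => i; rewrite !rowE. Qed.

Lemma derive_comp (U V W : normedModType R) (f : U -> V) (g : V -> W) (x v : U) :
  differentiable f x -> differentiable g (f x) ->
  'D_v (g \o f) x = 'D_('D_v f x) g (f x).
Proof.
move=> df dg; rewrite (deriveE _ df) (deriveE _ dg).
by rewrite (deriveE _ (differentiable_comp df dg)) (diff_comp df dg).
Qed.

Lemma jacobian_comp (F G : 'rV[R]_2 -> 'rV[R]_2) x :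
  differentiable F x -> differentiable G (F x) ->
  'J (G \o F) x = 'J F x *m 'J G (F x).
Proof.
move=> dF dG; have dGF := differentiable_comp dF dG.
apply: eq_mulmx_row => v.
have E1 : 'D_v (G \o F) x = v *m 'J (G \o F) x by exact: deriveEjacobian.
have E2 : 'D_v F x = v *m 'J F x by exact: deriveEjacobian.
have E3 : 'D_('D_v F x) G (F x) = 'D_v F x *m 'J G (F x) by exact: deriveEjacobian.
rewrite -E1 mulmxA -E2 -E3.
exact: derive_comp.
Qed.

Lemma jacobian_near (F G : 'rV[R]_2 -> 'rV[R]_2) x :
  differentiable F x -> (\forall y \near x, F y = G y) -> 'J F x = 'J G x.
Proof.
move=> dF FG; have dG := near_eq_differentiable FG dF.
apply: eq_mulmx_row => v.
have E1 : 'D_v F x = v *m 'J F x by exact: deriveEjacobian.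
have E2 : 'D_v G x = v *m 'J G x by exact: deriveEjacobian.
exact: etrans (esym E1) (etrans (near_eq_derive v FG) E2).
Qed.

Lemma jacobian_id (x : 'rV[R]_2) : 'J id x = 1%:M.
Proof.
apply: eq_mulmx_row => v; have did : differentiable (@id 'rV[R]_2) x by [].
have E1 : 'D_v id x = v *m 'J id x by exact: deriveEjacobian.
by rewrite mulmx1 -E1 derive_id.
Qed.

End jacobians.

Section surface_transitions.
Context {R : realType} (S : surface R).
Implicit Types (c d e : chart R S).

Lemma transition_differentiable c d x : atlas c -> atlas d -> overlap c d x ->
  differentiable (transition c d) x.
Proof.
by move=> ac ad; apply: smooth_on_differentiable; case: (atlas_oriented ac ad).
Qed.

Lemma jacobian_transition_comp c d e x : atlas c -> atlas d -> atlas e ->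
  overlap c d x -> overlap c e x ->
  'J (transition c e) x = 'J (transition c d) x *m 'J (transition d e) (transition c d x).
Proof.
move=> ac ad ae cdx cex.
have [cx dx] := (overlapP c d x).1 cdx; have [_ ex] := (overlapP c e x).1 cex.
have dex : overlap d e (transition c d x).
  apply/overlapP; rewrite cinv_transition//; split => //.
  exact: overlap_img (overlap_transition cdx).
rewrite -jacobian_comp; [|exact: transition_differentiable..].
apply: jacobian_near; first exact: transition_differentiable.
have sub y : overlap c d y ->
    transition c e y = (transition d e \o transition c d) y.
  by move=> /overlapP[cy dy]; rewrite /= transition_comp.
exact: (open_near (overlap_open c d) cdx sub).
Qed.

Lemma jacobian_transition_id c x : atlas c -> cimg c x -> 'J (transition c c) x = 1%:M.
Proof.
move=> ac cx; rewrite -(jacobian_id x); apply: jacobian_near.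
  by apply: transition_differentiable => //; apply/overlapP; split=> //; case: (cinvK cx).
have sub y : cimg c y -> transition c c y = id y.
  by move=> cy; rewrite /transition/=; case: (cinvK cy).
exact: (open_near (@cimg_open _ _ c) cx sub).
Qed.

Lemma jacobian_transitionV c d x : atlas c -> atlas d -> overlap c d x ->
  'J (transition d c) (transition c d x) = invmx ('J (transition c d) x).
Proof.
move=> ac ad cdx.
have cx := overlap_img cdx.
have ccx : overlap c c x by apply/overlapP; split=> //; case: (cinvK cx).
have := jacobian_transition_comp ac ad ac cdx ccx; rewrite jacobian_transition_id//.
have [_ /(_ x cdx) det0] := atlas_oriented ac ad.
have u : 'J (transition c d) x \in unitmx by rewrite unitmxE unitfE gt_eqF.
move=> /(congr1 (mulmx (invmx ('J (transition c d) x)))).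
by rewrite mulmxA mulVmx// mul1mx mulmx1.
Qed.

Lemma det_transition_gt0 c d x : atlas c -> atlas d -> overlap c d x ->
  0 < \det ('J (transition c d) x).
Proof. by move=> ac ad; case: (atlas_oriented ac ad) => _; exact. Qed.

End surface_transitions.

Section row_norm.
Context {R : realType}.

Lemma rV2_norm_le (z : 'rV[R]_2) (r : R) : 0 <= r ->
  `|z 0 0| <= r -> `|z 0 1| <= r -> `|z| <= r.
Proof.
move=> r0 z0 z1; rewrite /Num.norm/= mx_normrE; apply: bigmax_le => // -[i j] _ /=.
by rewrite (ord1 i); elim/ord2P: j.
Qed.

End row_norm.

(** * Global vector fields supported in one chart *)

Section bump_vector_fields.
Context {R : realType} (S : surface R) (c0 : chart R S) (x0 v0 : 'rV[R]_2) (r : R).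
Hypothesis ac0 : atlas c0.
Hypothesis r0 : 0 < r.
Hypothesis ball_c0 : closed_ball x0 r `<=` cimg c0.

(** The norm of ['rV[R]_2] is the maximum norm, which is not smooth, so the squared Euclidean
    distance is used; the Euclidean disc of radius [r] lies in the square [closed_ball x0 r]. *)
Definition bump (z : 'rV[R]_2) : R :=
  flat 0 (r ^+ 2 - ((z 0 0 - x0 0 0) ^+ 2 + (z 0 1 - x0 0 1) ^+ 2)).

Lemma bump_center : 0 < bump x0.
Proof. by apply: flat_gt0; rewrite !subrr expr0n/= addr0 subr0 exprn_gt0. Qed.

Lemma bump_support z : bump z != 0 -> closed_ball x0 r z.
Proof.
rewrite closed_ballE// /closed_ball_ /=; apply: contraNT; rewrite -ltNge => rz.
apply/eqP/flat_le0; rewrite subr_le0.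
suff [h|h] : r < `|z 0 0 - x0 0 0| \/ r < `|z 0 1 - x0 0 1|.
- have : r ^+ 2 <= `|z 0 0 - x0 0 0| ^+ 2 by rewrite ler_pXn2r ?nnegrE// ltW.
  rewrite real_normK ?num_real// => /le_trans; apply.
  by rewrite lerDl sqr_ge0.
- have : r ^+ 2 <= `|z 0 1 - x0 0 1| ^+ 2 by rewrite ler_pXn2r ?nnegrE// ltW.
  rewrite real_normK ?num_real// => /le_trans; apply.
  by rewrite lerDr sqr_ge0.
have [h0|h0] := leP `|z 0 0 - x0 0 0| r; last by left.
have [h1|h1] := leP `|z 0 1 - x0 0 1| r; last by right.
move: rz; rewrite ltNge => /negP[]; apply: rV2_norm_le; rewrite ?(ltW r0)// !mxE distrC//.
Qed.

Lemma bump_smooth W (w : 'rV[R]_2 -> 'rV[R]_2) : open W -> smooth_on W w ->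
  smooth_on W (bump \o w : 'rV[R]_2 -> R^o).
Proof.
move=> oW /smooth_on_coord-/(_ oW) sw.
have sq j : smooth_on W (fun y => (w y 0 j - x0 0 j) * (w y 0 j - x0 0 j) : R^o).
  by apply: smooth_onM => //; apply: smooth_onB => //; exact: smooth_on_cst.
have sd : smooth_on W (fun y => r ^+ 2 - ((w y 0 0 - x0 0 0) * (w y 0 0 - x0 0 0)
    + (w y 0 1 - x0 0 1) * (w y 0 1 - x0 0 1)) : R^o).
  by apply: smooth_onB => //; [exact: smooth_on_cst|exact: smooth_onD].
apply: smooth_on_ext (smooth_on_comp oW (J := setT) _ (fun n => within_C_flat n 0) sd) => //.
Qed.

(** The Hausdorff axiom enters here: the image of the square is compact, hence closed in the
    surface, so the extension by zero is smooth on an open complement. *)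
Lemma bump_support_closed : closed (cinv c0 @` closed_ball x0 r).
Proof.
apply: compact_closed; first exact: surface_hausdorff.
apply: continuous_compact.
  by apply: continuous_subspaceW ball_c0 _; exact: cinv_continuous.
apply: bounded_closed_compact; last exact: closed_ball_closed.
exists (`|x0| + r); split; first exact: num_real.
move=> m hm z; rewrite closed_ballE// /closed_ball_ /= => zr.
rewrite (le_trans _ (ltW hm))// -[z](subKr x0) (le_trans (ler_normB _ _))//.
by rewrite lerD2l.
Qed.

Definition bump_coef (c : chart R S) (y : 'rV[R]_2) : 'rV[R]_2 :=
  if `[< cdom c0 (cinv c y) >] then
    bump (transition c c0 y) *: (v0 *m 'J (transition c0 c) (transition c c0 y))
  else 0.

Lemma bump_coef_transition c d x : atlas c -> atlas d -> overlap c d x ->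
  bump_coef d (transition c d x) = bump_coef c x *m 'J (transition c d) x.
Proof.
move=> ac ad cdx; rewrite /bump_coef cinv_transition//.
case: asboolP => [c0x|_]; last by rewrite mul0mx.
have [cx dx] := (overlapP _ _ _).1 cdx.
have cc0 : overlap c c0 x by apply/overlapP.
rewrite transition_comp// -scalemxAl -mulmxA; congr (_ *: (_ *m _)).
have c0c := overlap_transition cc0.
have c0d : overlap c0 d (transition c c0 x).
  by apply/overlapP; split; [exact: overlap_img c0c|rewrite cinv_transition].
have J := jacobian_transition_comp ac0 ac ad c0c c0d.
by rewrite transitionK in J.
Qed.

Lemma bump_coef_smooth c : atlas c -> smooth_on (cimg c) (bump_coef c).
Proof.
move=> ac; apply: smooth_on_near => y cy.
have [c0y|c0y] := pselect (cdom c0 (cinv c y)).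
  exists (overlap c c0); first exact/overlapP.
  have oW := overlap_open c c0.
  have [st _] := atlas_oriented ac ac0.
  apply/smooth_on_coord => // j.
  have sJ i k := smooth_on_jacobian i k oW st.
  have sb := bump_smooth oW st.
  pose T := transition c c0.
  have T0 z : overlap c c0 z -> 0 < \det ('J T z) by exact: det_transition_gt0.
  have sdet : smooth_on (overlap c c0) (fun y => (\det ('J T y))^-1 : R^o).
    apply: smooth_onV => //.
    apply: (@smooth_on_ext _ _ _
      (fun y => 'J T y 0 0 * 'J T y 1 1 - 'J T y 0 1 * 'J T y 1 0)) => //.
      by move=> z _; rewrite det2.
    by apply: smooth_onB => //; apply: smooth_onM => //; exact: sJ.
  (* The Jacobian of the transition from [c0] to [c] is rewritten as an inverse matrix in the
     coordinates of [c], so that Cramer's rule exhibits smooth coefficients. *)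
  have E z : overlap c c0 z ->
      bump_coef c z = bump (T z) *: (v0 *m invmx ('J T z)).
    move=> cz; have [_ c0z] := (overlapP _ _ _).1 cz.
    by rewrite /bump_coef asboolT// jacobian_transitionV.
  have sv i : smooth_on (overlap c c0) (fun=> v0 0 i : R^o) by exact: smooth_on_cst.
  elim/ord2P: j.
    apply: (@smooth_on_ext _ _ _ (fun y => bump (T y) *
      ((\det ('J T y))^-1 * (v0 0 0 * 'J T y 1 1 - v0 0 1 * 'J T y 1 0)))) => //.
      move=> z cz; rewrite E// [RHS]mxE mulmx2E.
      have [|-> _ -> _] := @invmx2 _ ('J T z); first by rewrite gt_eqF// T0.
      by congr (_ * _); ring.
    by do 2 (apply: smooth_onM => //); apply: smooth_onB => //;
      apply: smooth_onM => //; exact: sJ.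
  apply: (@smooth_on_ext _ _ _ (fun y => bump (T y) *
    ((\det ('J T y))^-1 * (v0 0 1 * 'J T y 0 0 - v0 0 0 * 'J T y 0 1)))) => //.
    move=> z cz; rewrite E// [RHS]mxE mulmx2E.
    have [|_ -> _ ->] := @invmx2 _ ('J T z); first by rewrite gt_eqF// T0.
    by congr (_ * _); ring.
  by do 2 (apply: smooth_onM => //); apply: smooth_onB => //;
    apply: smooth_onM => //; exact: sJ.
(* At a point outside the domain of [c0] the field vanishes on a whole neighbourhood: the complement
   of the closed support, which may well meet that domain. *)
exists [set z | cimg c z /\ (~` (cinv c0 @` closed_ball x0 r)) (cinv c z)].
  split=> // -[z zb zy]; apply: c0y; rewrite -zy.
  by have [] := cinvK (ball_c0 zb).
apply: smooth_on_ext (smooth_on_cst _ 0) => [|z [cz Kz]].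
  by apply: overlap_preimage_open; rewrite openC; exact: bump_support_closed.
rewrite /bump_coef; case: asboolP => // c0z.
have [->|b0] := eqVneq (bump (transition c c0 z)) 0; first by rewrite scale0r.
exfalso; apply: Kz; exists (transition c c0 z); first exact: bump_support.
by rewrite cinv_transition//; apply/overlapP.
Qed.

Definition bump_field : vector_field S :=
  VectorField bump_coef_transition bump_coef_smooth.

Lemma bump_fieldE : bump_field c0 x0 = bump x0 *: v0.
Proof.
have cx0 : cimg c0 x0 by apply: ball_c0; exact: closed_ballxx.
have [xx cc] := cinvK cx0; rewrite /= /bump_coef asboolT//.
have -> : transition c0 c0 x0 = x0 by [].
by rewrite jacobian_transition_id// mulmx1.
Qed.

End bump_vector_fields.

(* [codazzi_pair] quantifies over global vector fields; this makes it a
   pointwise condition. *)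
Lemma vector_field_value {R : realType} (S : surface R) (c : chart R S)
    (x v : 'rV[R]_2) : atlas c -> cimg c x -> exists X : vector_field S, X c x = v.
Proof.
move=> ac cx.
have : nbhs x (cimg c) by apply: open_nbhs_nbhs; split=> //; exact: cimg_open.
move=> /nbhs_closedballP[r rc].
have r0 : 0 < r%:num by [].
have b0 := bump_center x r0.
exists (bump_field ((bump x r%:num x)^-1 *: v) ac r0 rc).
by rewrite bump_fieldE scalerA mulfV ?scale1r// gt_eqF.
Qed.

(** * Metrics and the Codazzi equation in coordinates *)

Section metrics.
Context {R : realType}.

Lemma quadratic_value (B : 'M[R]_2) (v : 'rV[R]_2) :
  (v *m B *m v^T) 0 0 = v 0 0 * (v 0 0 * B 0 0 + v 0 1 * B 1 0)
    + v 0 1 * (v 0 0 * B 0 1 + v 0 1 * B 1 1).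
Proof. by rewrite !mulmx2E ![v^T _ _]mxE; ring. Qed.

Lemma posdef2P (B : 'M[R]_2) : B^T = B ->
  (forall v : 'rV[R]_2, v != 0 -> 0 < (v *m B *m v^T) 0 0) <->
  0 < B 0 0 /\ 0 < \det B.
Proof.
move=> sB; have B10 : B 1 0 = B 0 1 by rewrite -{1}sB mxE.
have rV0 (v : 'rV[R]_2) : (v == 0) = (v 0 0 == 0) && (v 0 1 == 0).
  apply/eqP/andP => [->|[/eqP v0 /eqP v1]]; first by rewrite !mxE.
  by apply/rowP; apply: ord2P; rewrite !mxE.
rewrite det2 B10; split=> [H|[B0 dB] v v0].
  have B0 : 0 < B 0 0.
    have := H (\row_j (if j == 0 then 1 else 0)); rewrite quadratic_value !mxE/=.
    by rewrite rV0 !mxE/= oner_eq0 => /(_ erefl); rewrite !mul1r !mul0r !addr0.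
  (* The test vector is the [B]-orthogonal of the first basis vector; the form takes the value
     [B 0 0 * \det B] on it. *)
  split=> //; have := H (\row_j (if j == 0 then - B 0 1 else B 0 0)).
  rewrite quadratic_value B10 rV0 !mxE/= (gt_eqF B0) andbF => /(_ erefl).
  have -> : - B 0 1 * (- B 0 1 * B 0 0 + B 0 0 * B 0 1) +
    B 0 0 * (- B 0 1 * B 0 1 + B 0 0 * B 1 1) =
    B 0 0 * (B 0 0 * B 1 1 - B 0 1 * B 0 1) by ring.
  by rewrite pmulr_rgt0.
rewrite quadratic_value B10 -(pmulr_rgt0 _ B0).
have -> : B 0 0 * (v 0 0 * (v 0 0 * B 0 0 + v 0 1 * B 0 1) +
    v 0 1 * (v 0 0 * B 0 1 + v 0 1 * B 1 1)) =
  (B 0 0 * v 0 0 + B 0 1 * v 0 1) ^+ 2 +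
  (B 0 0 * B 1 1 - B 0 1 * B 0 1) * v 0 1 ^+ 2 by ring.
have [v1|v1] := eqVneq (v 0 1) 0; last first.
  by rewrite ltr_wpDl ?sqr_ge0// mulr_gt0// exprn_even_gt0.
move: v0; rewrite rV0 v1 eqxx andbT mulr0 addr0 expr0n/= mulr0 addr0 => v0.
by rewrite exprn_even_gt0//= mulf_neq0// gt_eqF.
Qed.

End metrics.

(** * The shape operator and the Codazzi equation at a point *)

Section shape_operator.
Context {R : realType} (S : surface R).
Implicit Types (g B : quadratic_form S) (P : fundamental_pair S) (c : chart R S).

Lemma metric_gt0 g c x : riemannian_metric g -> atlas c -> cimg c x ->
  0 < g c x 0 0 /\ 0 < \det (g c x).
Proof.
move=> mg ac cx; apply/posdef2P; first exact: qcoef_sym.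
by move=> v v0; exact: mg.
Qed.

Lemma qcoef10 g c x : atlas c -> cimg c x -> g c x 1 0 = g c x 0 1.
Proof. by move=> ac cx; rewrite -{1}(qcoef_sym g ac cx) mxE. Qed.

Lemma det_qcoef_smooth g c : atlas c ->
  smooth_on (cimg c) (fun x => \det (g c x) : R^o).
Proof.
move=> ac; have oc : open (cimg c) by exact: cimg_open.
apply: (@smooth_on_ext _ _ _
  (fun x => g c x 0 0 * g c x 1 1 - g c x 0 1 * g c x 1 0 : R^o)) => //.
  by move=> x _; rewrite det2.
by apply: smooth_onB => //; apply: smooth_onM => //; exact: qcoef_smooth.
Qed.

Lemma invmx_qcoef_smooth g c i j : riemannian_metric g -> atlas c ->
  smooth_on (cimg c) (fun x => invmx (g c x) i j : R^o).
Proof.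
move=> mg ac; have oc : open (cimg c) by exact: cimg_open.
have d0 x : cimg c x -> 0 < \det (g c x) by move=> cx; have [] := metric_gt0 mg ac cx.
have sV : smooth_on (cimg c) (fun x => (\det (g c x))^-1 : R^o).
  by apply: smooth_onV => //; exact: det_qcoef_smooth.
have sg k l : smooth_on (cimg c) (fun x => g c x k l : R^o) by exact: qcoef_smooth.
have sgV k l : smooth_on (cimg c) (fun x => g c x k l / \det (g c x) : R^o).
  exact: smooth_onM.
have sNV k l : smooth_on (cimg c) (fun x => - g c x k l / \det (g c x) : R^o).
  by apply: smooth_onM => //; exact: smooth_onN.
have inv x : cimg c x -> _ := fun cx => invmx2 (lt0r_neq0 (d0 x cx)).
elim/ord2P: i; elim/ord2P: j.
- by apply: smooth_on_ext (sgV 1 1) => // x /inv[].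
- by apply: smooth_on_ext (sNV 0 1) => // x /inv[].
- by apply: smooth_on_ext (sNV 1 0) => // x /inv[].
- by apply: smooth_on_ext (sgV 0 0) => // x /inv[].
Qed.

Lemma shape_smooth P c i j : atlas c ->
  smooth_on (cimg c) (fun x => Defs.shape P c x i j : R^o).
Proof.
move=> ac; have oc : open (cimg c) by exact: cimg_open.
apply: (@smooth_on_ext _ _ _ (fun x => formII P c x i 0 * invmx (formI P c x) 0 j
  + formII P c x i 1 * invmx (formI P c x) 1 j : R^o)) => //.
  by move=> x cx; rewrite /Defs.shape mulmx2E.
by apply: smooth_onD => //; apply: smooth_onM => //;
  [exact: qcoef_smooth|exact: invmx_qcoef_smooth (formI_metric P) ac|
   exact: qcoef_smooth|exact: invmx_qcoef_smooth (formI_metric P) ac].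
Qed.

(** The differentiated terms stay abstract ([a], [b] for the fields [SY], [SX], and [l - m] for the
    bracket), so that only linear algebra at the point is expanded. *)
Lemma codazzi_coord (G : 'I_2 -> 'I_2 -> 'I_2 -> R) (s : 'M[R]_2) (a b l m : 'rV[R]_2) k :
  ((a + \row_(k < 2) \sum_(i < 2) \sum_(j < 2)
       G k i j * ('e_0 : 'rV[R]_2) 0 i * (('e_1 : 'rV[R]_2) *m s) 0 j)
   - (b + \row_(k < 2) \sum_(i < 2) \sum_(j < 2)
       G k i j * ('e_1 : 'rV[R]_2) 0 i * (('e_0 : 'rV[R]_2) *m s) 0 j)
   - (l - m) *m s) 0 k =
  a 0 k - b 0 k - (l *m s) 0 k + (m *m s) 0 k + (G k 0 0 * s 1 0 + G k 0 1 * s 1 1)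
    - (G k 1 0 * s 0 0 + G k 1 1 * s 0 1).
Proof. by rewrite mulmxBl !mxE !sum_ord2 !mulmx2E !mxE/=; ring. Qed.

(** The two fields are prescribed only at [x]. Their first derivatives come in through the product
    rule for [SX] and [SY] and cancel against the bracket term, whatever they are. *)
Lemma codazzi_pointwise P c x k : codazzi_pair P -> atlas c -> cimg c x ->
  'D_('e_0) (fun y => Defs.shape P c y 1 k : R^o) x
  - 'D_('e_1) (fun y => Defs.shape P c y 0 k : R^o) x
  + (christoffel (formI P c) k 0 0 x * Defs.shape P c x 1 0
     + christoffel (formI P c) k 0 1 x * Defs.shape P c x 1 1)
  - (christoffel (formI P c) k 1 0 x * Defs.shape P c x 0 0
     + christoffel (formI P c) k 1 1 x * Defs.shape P c x 0 1) = 0.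
Proof.
move=> cod ac cx.
have [X Xx] := vector_field_value 'e_0 ac cx.
have [Y Yx] := vector_field_value 'e_1 ac cx.
have dS i j : differentiable (fun y => Defs.shape P c y i j : R^o) x.
  exact: (smooth_on_differentiable (shape_smooth P i j ac) cx).
have dV (Z : vector_field S) : differentiable (Z c) x.
  exact: (smooth_on_differentiable (vcoef_smooth Z ac) cx).
have dVj (Z : vector_field S) j : differentiable (fun y => Z c y 0 j : R^o) x.
  exact: (@differentiable_comp _ _ _ _ (Z c) (fun v : 'rV[R]_2 => v 0 j : R^o) _
    (dV Z) (differentiable_coord _ _ _)).
have D (Z : vector_field S) v : 'D_v (fun y => Z c y *m Defs.shape P c y) x 0 k =
    ('D_v (Z c) x *m Defs.shape P c x) 0 k
    + (Z c x 0 0 * 'D_v (fun y => Defs.shape P c y 0 k : R^o) x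
       + Z c x 0 1 * 'D_v (fun y => Defs.shape P c y 1 k : R^o) x).
  have dZS : derivable (fun y => Z c y *m Defs.shape P c y) x v.
    apply/derivable_mxP => i j; rewrite (ord1 i).
    have -> : (fun y => (Z c y *m Defs.shape P c y) 0 j) =
        (fun y => Z c y 0 0 : R^o) * (fun y => Defs.shape P c y 0 j : R^o)
        + (fun y => Z c y 0 1 : R^o) * (fun y => Defs.shape P c y 1 j : R^o).
      by apply/funext => y; rewrite mulmx2E.
    by apply: diff_derivable; apply: differentiableD; apply: (@differentiableM R).
  rewrite derive_mx// mxE.
  have -> : (fun y => (Z c y *m Defs.shape P c y) 0 k) =
      (fun y => Z c y 0 0 : R^o) * (fun y => Defs.shape P c y 0 k : R^o)
      + (fun y => Z c y 0 1 : R^o) * (fun y => Defs.shape P c y 1 k : R^o).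
    by apply/funext => y; rewrite mulmx2E.
  have dm i : derivable ((fun y => Z c y 0 i : R^o) *
      (fun y => Defs.shape P c y i k : R^o)) x v.
    by apply: derivableM; apply: diff_derivable.
  have dM i : 'D_v ((fun y => Z c y 0 i : R^o) *
      (fun y => Defs.shape P c y i k : R^o)) x =
      Z c x 0 i * 'D_v (fun y => Defs.shape P c y i k : R^o) x +
      Defs.shape P c x i k * 'D_v (Z c) x 0 i.
    rewrite -(derive_coord v i (dV Z)); apply: deriveM; exact: diff_derivable.
  rewrite (deriveD (dm 0) (dm 1)) !dM mulmx2E; ring.
have := congr1 (fun M : 'rV[R]_2 => M 0 k) (cod X Y c x ac cx).
rewrite /levi_civita /lie_bracket Xx Yx /= codazzi_coord !D Xx Yx [RHS]mxE => <-.
have e00 : ('e_0 : 'rV[R]_2) 0 0 = 1 by rewrite mxE.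
have e01 : ('e_0 : 'rV[R]_2) 0 1 = 0 by rewrite mxE.
have e10 : ('e_1 : 'rV[R]_2) 0 0 = 0 by rewrite mxE.
have e11 : ('e_1 : 'rV[R]_2) 0 1 = 1 by rewrite mxE.
rewrite e00 e01 e10 e11 !mul1r !mul0r add0r addr0.
set a := 'D_('e_0) (fun y => Defs.shape P c y 1 k) x.
set b := 'D_('e_1) (fun y => Defs.shape P c y 0 k) x.
set l := (_ *m _) 0 k; set m := (_ *m _) 0 k.
move: (christoffel _ _ _ _ _ * _ + _) (christoffel _ _ _ _ _ * _ + _) => u v.
by move: a b l m u v => *; ring.
Qed.

End shape_operator.

(** * The deformed metric and the Hopf differential *)

Section curvature_algebra.
Context {F : fieldType}.
Implicit Types (g b A B : 'M[F]_2).

(** Matrix of the coordinate area form. Divided by the square root of [\det g], the product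
    [eps2 *m g] has square -1 and is the complex structure of [g] acting on covectors. *)
Definition eps2 : 'M[F]_2 :=
  \matrix_(i, j) (if i == j then 0 else if i == 0 then 1 else -1).

(** Polarisation of the determinant on symmetric matrices. For invertible [A] it is [\det A] times
    the trace of [B *m invmx A], so its vanishing expresses that [B] is traceless for [A] without
    any inverse. *)
Definition mixed_det A B : F := A 0 0 * B 1 1 - 2 * A 0 1 * B 0 1 + A 1 1 * B 0 0.

Lemma sym2 A : A^T = A -> A 1 0 = A 0 1.
Proof. by move=> sA; rewrite -{1}sA mxE. Qed.

Lemma eps2E : [/\ eps2 0 0 = 0, eps2 0 1 = 1, eps2 1 0 = -1 & eps2 1 1 = 0].
Proof. by rewrite !mxE. Qed.

Lemma conj_eps2 (T : 'M[F]_2) : T^T *m eps2 *m T = \det T *: eps2.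
Proof.
have [e00 e01 e10 e11] := eps2E.
apply: mx2P; rewrite !mulmx2E ![T^T _ _]mxE e00 e01 e10 e11 [RHS]mxE det2;
  rewrite ?e00 ?e01 ?e10 ?e11; ring.
Qed.

Lemma traceless_mixed_det g b : (2 : F) != 0 -> g^T = g -> b^T = b -> \det g != 0 ->
  mixed_det g (b - (\tr (b *m invmx g) / 2) *: g) = 0.
Proof.
move=> n2 /sym2 g10 /sym2 b10 g0; have [i00 i01 i10 i11] := invmx2 g0.
rewrite /mixed_det !mxE mxtrace2 !mulmx2E i00 i01 i10 i11 b10 g10.
by move: g0; rewrite det2 g10 => g0; field; rewrite g0 n2.
Qed.

Lemma det_traceless g b : (2 : F) != 0 -> g^T = g -> b^T = b -> \det g != 0 ->
  let H := \tr (b *m invmx g) / 2 in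
  \det (b - H *: g) = - (H ^+ 2 - \det (b *m invmx g)) * \det g.
Proof.
move=> n2 sg sb g0 H; have := traceless_mixed_det n2 sg sb g0.
rewrite det_mulmx det_inv -/H /mixed_det [\det (b - _)]det2 !mxE.
move: (sym2 sg) (sym2 sb) (g0) => g10 b10; rewrite !det2 g10 b10 => d0 E.
apply/eqP; rewrite -subr_eq0; apply/eqP.
(* The two sides differ by [- H] times the mixed determinant of [g] and [b - H *: g], which is 0. *)
rewrite -[RHS](mulr0 (- H)) -E; field.
by rewrite d0.
Qed.

Section deformation.
Variables (g b0 : 'M[F]_2) (C s u : F).
Hypothesis sg : g^T = g.
Hypothesis sb0 : b0^T = b0.
Hypothesis g0 : \det g != 0.
Hypothesis traceless : mixed_det g b0 = 0.
Hypothesis det_b0 : \det b0 = - u * \det g.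
Hypothesis Csu : C ^+ 2 - u * s ^+ 2 = 1.

(* [metric_part] and [hopf_part] are A and Q + conj Q. *)
Definition metric_part := C *: g + s *: b0.
Definition hopf_part := (u * s) *: g + C *: b0.

Let g10 := sym2 sg.
Let b10 := sym2 sb0.

Lemma metric_partK : C *: metric_part - s *: hopf_part = g.
Proof.
by apply/matrixP => i j; rewrite !mxE -[RHS]mul1r -Csu; ring.
Qed.

Lemma hopf_partK : C *: hopf_part - (u * s) *: metric_part = b0.
Proof.
by apply/matrixP => i j; rewrite !mxE -[RHS]mul1r -Csu; ring.
Qed.

(** The mixed term drops out of the expanded determinant and [C ^+ 2 - u * s ^+ 2 = 1] does the
    rest. In a conformal parameter it identifies the square root of [\det g] with the conformal
    factor of [A]. *)
Lemma det_metric_part : \det metric_part = \det g.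
Proof.
move: traceless det_b0; rewrite /mixed_det /metric_part !det2 !mxE g10 b10 => T D.
have -> : (C * g 0 0 + s * b0 0 0) * (C * g 1 1 + s * b0 1 1) -
  (C * g 0 1 + s * b0 0 1) * (C * g 0 1 + s * b0 0 1) =
  C ^+ 2 * (g 0 0 * g 1 1 - g 0 1 * g 0 1) + s ^+ 2 * (b0 0 0 * b0 1 1 - b0 0 1 * b0 0 1)
  + C * s * (g 0 0 * b0 1 1 - 2 * g 0 1 * b0 0 1 + g 1 1 * b0 0 0) by ring.
rewrite T D; have -> : C ^+ 2 = 1 + u * s ^+ 2 by rewrite -Csu; ring.
ring.
Qed.

Lemma mixed_metric_hopf : mixed_det metric_part hopf_part = 0.
Proof.
move: traceless det_b0; rewrite /mixed_det /metric_part /hopf_part !det2 !mxE g10 b10 => T D.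
pose W := g 0 0 * g 1 1 - g 0 1 * g 0 1.
transitivity (2 * C * s * (u * W + (b0 0 0 * b0 1 1 - b0 0 1 * b0 0 1))
  + (C ^+ 2 + u * s ^+ 2) * (g 0 0 * b0 1 1 - 2 * g 0 1 * b0 0 1 + g 1 1 * b0 0 0)).
  by rewrite /W; ring.
by rewrite T D /W; ring.
Qed.

Lemma det_hopf_part : \det hopf_part = - u * \det g.
Proof.
move: traceless det_b0; rewrite /mixed_det /hopf_part !det2 !mxE g10 b10 => T D.
transitivity ((u * s) ^+ 2 * (g 0 0 * g 1 1 - g 0 1 * g 0 1) +
   C ^+ 2 * (b0 0 0 * b0 1 1 - b0 0 1 * b0 0 1) +
   u * s * C * (g 0 0 * b0 1 1 - 2 * g 0 1 * b0 0 1 + g 1 1 * b0 0 0)); first by ring.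
rewrite T D; have -> : C ^+ 2 = 1 + u * s ^+ 2 by rewrite -Csu; ring.
ring.
Qed.

Lemma traceless_eps2_sym : (b0 *m eps2 *m g)^T = b0 *m eps2 *m g.
Proof.
have [e00 e01 e10 e11] := eps2E; move: traceless; rewrite /mixed_det => T.
apply: mx2P; rewrite !mxE !sum_ord2 !mulmx2E e00 e01 e10 e11 ?g10 ?b10; try ring.
- by rewrite -[LHS]addr0 -[X in _ + X = _]T; ring.
- by rewrite -[LHS]subr0 -[X in _ - X = _]T; ring.
Qed.

(** Of the four products, the two multiples of [eps2] cancel, and the cross terms are opposite up to
    the factors [C ^+ 2] and [u * s ^+ 2]. Hence rotating the real part of Q for [A] amounts to
    rotating [b0] for [g]. *)
Lemma hopf_eps2_metric : hopf_part *m eps2 *m metric_part = b0 *m eps2 *m g.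
Proof.
have gg : g *m eps2 *m g = \det g *: eps2 by rewrite -{1}sg conj_eps2.
have bb : b0 *m eps2 *m b0 = (- u * \det g) *: eps2 by rewrite -{1}sb0 conj_eps2 det_b0.
have gb : g *m eps2 *m b0 = - (b0 *m eps2 *m g).
  rewrite -traceless_eps2_sym !trmx_mul sg sb0 mulmxA.
  have -> : eps2^T = - eps2.
    by have [e00 e01 e10 e11] := eps2E; apply: mx2P; rewrite !mxE/= ?oppr0 ?opprK.
  by rewrite mulmxN mulNmx opprK.
rewrite /hopf_part /metric_part !mulmxDl !mulmxDr -!scalemxAl -!scalemxAr.
rewrite gg bb gb; apply/matrixP => i j.
move: (b0 *m eps2 *m g) => M; rewrite !mxE -[RHS]mul1r -Csu; ring.
Qed.

(** For the traceless operator [T = b0 *m invmx g], Cayley-Hamilton gives [T ^ 2 = u], hence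
    [T (C + s T) = u s + C T]. The operator that represents [b0] for [g] therefore represents
    [hopf_part] for [metric_part]. *)
Lemma hopf_shape : hopf_part = b0 *m invmx g *m metric_part.
Proof.
have ug : g \in unitmx by rewrite unitmxE unitfE.
have CH (T : 'M[F]_2) : \tr T = 0 -> T *m T = (- \det T) *: 1%:M.
  rewrite mxtrace2 det2 => /eqP; rewrite addr_eq0 => /eqP T0.
  by apply: mx2P; rewrite mulmx2E !mxE/= T0; ring.
have T0 : \tr (b0 *m invmx g) = 0.
  have [i00 i01 i10 i11] := invmx2 g0; move: traceless; rewrite /mixed_det => T.
  rewrite mxtrace2 !mulmx2E i00 i01 i10 i11 b10 g10.
  by rewrite -(mul0r (\det g)^-1) -T; ring.
have b0E : b0 *m invmx g *m g = b0 by rewrite -mulmxA mulVmx// mulmx1.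
rewrite /metric_part mulmxDr -!scalemxAr b0E -{3}b0E !mulmxA.
rewrite -(mulmxA (b0 *m invmx g) b0) (CH _ T0) det_mulmx det_inv det_b0 mulNr.
have -> : - (- (u * \det g) / \det g) = u by field.
by rewrite -scalemxAl mul1mx scalerA (mulrC s) addrC.
Qed.

End deformation.

End curvature_algebra.

(** * Invariant functions and quadratic forms built from a fundamental pair *)

Section invariant_forms.
Context {R : realType} (S : surface R).
Implicit Types (g b : quadratic_form S) (P : fundamental_pair S) (c d : chart R S).

Definition scalar_field (al : chart R S -> 'rV[R]_2 -> R) : Prop :=
  (forall c d x, atlas c -> atlas d -> overlap c d x -> al c x = al d (transition c d x)) /\
  (forall c, atlas c -> smooth_on (cimg c) (al c : 'rV[R]_2 -> R^o)).

Lemma scalar_fieldM al be : scalar_field al -> scalar_field be ->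
  scalar_field (fun c x => al c x * be c x).
Proof.
move=> [al1 al2] [be1 be2]; split=> [c d x ac ad cdx|c ac].
  by rewrite (al1 c d)// (be1 c d).
by apply: smooth_onM; [exact: cimg_open|exact: al2|exact: be2].
Qed.

Lemma scalar_field_cst (k : R) : scalar_field (fun _ _ => k).
Proof. by split=> // c ac; exact: smooth_on_cst. Qed.

Lemma scalar_fieldB al be : scalar_field al -> scalar_field be ->
  scalar_field (fun c x => al c x - be c x).
Proof.
move=> [al1 al2] [be1 be2]; split=> [c d x ac ad cdx|c ac].
  by rewrite (al1 c d)// (be1 c d).
by apply: smooth_onB; [exact: cimg_open|exact: al2|exact: be2].
Qed.

Lemma scalar_field_comp (J : set R) (F : R -> R) al : scalar_field al ->
  (forall c x, atlas c -> cimg c x -> J (al c x)) -> (forall n, within_C n J F) ->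
  scalar_field (fun c x => F (al c x)).
Proof.
move=> [al1 al2] Jal CF; split=> [c d x ac ad cdx|c ac]; first by rewrite (al1 c d).
by apply: (smooth_on_comp _ _ CF (al2 c ac)); [exact: cimg_open|move=> x; exact: Jal].
Qed.

Lemma quadratic_combination g b al be : scalar_field al -> scalar_field be ->
  exists Q : quadratic_form S, forall c x, Q c x = al c x *: g c x + be c x *: b c x.
Proof.
move=> [al1 al2] [be1 be2].
unshelve eexists (@QuadraticForm _ _ (fun c x => al c x *: g c x + be c x *: b c x) _ _ _) => //.
- by move=> c x ac cx; rewrite linearD/= !linearZ/= !qcoef_sym.
- move=> c d x ac ad cdx /=; rewrite (al1 c d)// (be1 c d)//.
  rewrite (qcoef_transition g ac ad cdx) (qcoef_transition b ac ad cdx).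
  by rewrite mulmxDr mulmxDl -!scalemxAr -!scalemxAl.
- move=> c i j ac.
  apply: (@smooth_on_ext _ _ _ (fun x => al c x * g c x i j + be c x * b c x i j : R^o)).
  + exact: cimg_open.
  + by move=> x cx; rewrite !mxE.
  + have oc : open (cimg c) by exact: cimg_open.
    by apply: smooth_onD => //; apply: smooth_onM => //;
      [exact: al2|exact: qcoef_smooth|exact: be2|exact: qcoef_smooth].
Qed.

Lemma shape_mulmx P c x : atlas c -> cimg c x ->
  Defs.shape P c x *m formI P c x = formII P c x.
Proof.
move=> ac cx; have [_ d0] := metric_gt0 (formI_metric P) ac cx.
by rewrite /Defs.shape -mulmxA mulVmx ?mulmx1// unitmxE unitfE gt_eqF.
Qed.

Lemma shape_transition P c d x : atlas c -> atlas d -> overlap c d x ->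
  Defs.shape P c x *m 'J (transition c d) x
  = 'J (transition c d) x *m Defs.shape P d (transition c d x).
Proof.
move=> ac ad cdx; have cx := overlap_img cdx.
have dx := overlap_img (overlap_transition cdx).
have := shape_mulmx P ac cx.
rewrite (qcoef_transition (formI P) ac ad cdx) (qcoef_transition (formII P) ac ad cdx).
rewrite -(shape_mulmx P ad dx).
have [_ d0] := metric_gt0 (formI_metric P) ad dx.
have J0 := det_transition_gt0 ac ad cdx.
have uI : formI P d (transition c d x) *m ('J (transition c d) x)^T \in unitmx.
  by rewrite unitmx_mul unitmx_tr !unitmxE !unitfE !gt_eqF.
move: (Defs.shape P c x) (Defs.shape P d (transition c d x)) uI J0.
move: (formI P d (transition c d x)) ('J (transition c d) x) => g J s s' uI J0 E.
have : s *m J *m (g *m J^T) = J *m s' *m (g *m J^T) by move: E; rewrite !mulmxA.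
by move=> /(congr1 (mulmx^~ (invmx (g *m J^T)))); rewrite /= !mulmxK.
Qed.

Lemma mean_curvature_field P : scalar_field (mean_curvature P).
Proof.
split=> [c d x ac ad cdx|c ac].
  have E := shape_transition P ac ad cdx.
  have J0 := det_transition_gt0 ac ad cdx.
  rewrite /mean_curvature; congr (_ / 2).
  move: (Defs.shape P c x) (Defs.shape P d (transition c d x)) E J0.
  move: ('J (transition c d) x) => J s s' E J0.
  have uJ : J \in unitmx by rewrite unitmxE unitfE gt_eqF.
  by rewrite -[s](mulmxK uJ) E -mulmxA mxtrace_mulC -mulmxA mulVmx ?mulmx1.
have oc : open (cimg c) by exact: cimg_open.
apply: (@smooth_on_ext _ _ _
  (fun x => (Defs.shape P c x 0 0 + Defs.shape P c x 1 1) * 2^-1 : R^o)) => //.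
  by move=> x cx; rewrite /mean_curvature mxtrace2.
apply: smooth_onM => //; last exact: smooth_on_cst.
by apply: smooth_onD => //; exact: shape_smooth.
Qed.

Lemma extrinsic_curvature_field P : scalar_field (extrinsic_curvature P).
Proof.
split=> [c d x ac ad cdx|c ac].
  have E := shape_transition P ac ad cdx.
  have J0 := det_transition_gt0 ac ad cdx.
  rewrite /extrinsic_curvature.
  move: (Defs.shape P c x) (Defs.shape P d (transition c d x)) E J0.
  move: ('J (transition c d) x) => J s s' /(congr1 determinant).
  rewrite !det_mulmx mulrC => E J0; apply: (mulfI (lt0r_neq0 J0)).
  exact: E.
have oc : open (cimg c) by exact: cimg_open.
apply: (@smooth_on_ext _ _ _ (fun x => Defs.shape P c x 0 0 * Defs.shape P c x 1 1
  - Defs.shape P c x 0 1 * Defs.shape P c x 1 0 : R^o)) => //.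
  by move=> x cx; rewrite /extrinsic_curvature det2.
by apply: smooth_onB => //; apply: smooth_onM => //; exact: shape_smooth.
Qed.

(** Orientation is used here: a change of chart multiplies the product by [\det J] and the square
    root by its absolute value, and these agree because transition Jacobians are positive. The
    factor 2 is there because the real part of Q is half of [hopf_part]. *)
Lemma quadratic_rotation g b : riemannian_metric g ->
  (forall c x, atlas c -> cimg c x -> mixed_det (g c x) (b c x) = 0) ->
  exists Q : quadratic_form S, forall c x,
    Q c x = (2 * Num.sqrt (\det (g c x)))^-1 *: (b c x *m eps2 *m g c x).
Proof.
move=> mg tb.
have d0 c x : atlas c -> cimg c x -> 0 < \det (g c x).
  by move=> ac cx; have [] := metric_gt0 mg ac cx.
unshelve eexists (@QuadraticForm _ _
  (fun c x => (2 * Num.sqrt (\det (g c x)))^-1 *: (b c x *m eps2 *m g c x)) _ _ _) => //.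
- move=> c x ac cx; rewrite linearZ/= traceless_eps2_sym//.
  + exact: qcoef_sym.
  + exact: qcoef_sym.
  + exact: tb.
- move=> c d x ac ad cdx /=.
  have J0 := det_transition_gt0 ac ad cdx.
  have D0 := d0 d _ ad (overlap_img (overlap_transition cdx)).
  rewrite (qcoef_transition g ac ad cdx) (qcoef_transition b ac ad cdx).
  move: ('J (transition c d) x) (g d _) (b d _) J0 D0 => J g' b' J0 D0.
  have JJ : J^T *m eps2 *m J = \det J *: eps2 by exact: conj_eps2.
  have -> : Num.sqrt (\det (J *m g' *m J^T)) = \det J * Num.sqrt (\det g').
    rewrite !det_mulmx det_tr mulrAC -expr2 sqrtrM ?sqr_ge0// sqrtr_sqr.
    by rewrite ger0_norm// ltW.
  have -> : J *m b' *m J^T *m eps2 *m (J *m g' *m J^T) =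
      \det J *: (J *m (b' *m eps2 *m g') *m J^T).
    have -> : J *m b' *m J^T *m eps2 *m (J *m g' *m J^T) =
        J *m b' *m (J^T *m eps2 *m J) *m g' *m J^T by rewrite !mulmxA.
    by rewrite JJ -scalemxAr -!scalemxAl !mulmxA.
  rewrite -scalemxAr -scalemxAl scalerA; congr (_ *: _).
  have sD : Num.sqrt (\det g') != 0 by rewrite gt_eqF// sqrtr_gt0.
  by field; rewrite sD gt_eqF.
- move=> c i j ac; have oc : open (cimg c) by exact: cimg_open.
  have sg k l := qcoef_smooth g k l ac; have sb k l := qcoef_smooth b k l ac.
  apply: (@smooth_on_ext _ _ _ (fun x => (2 * Num.sqrt (\det (g c x)))^-1 *
     (b c x i 0 * g c x 1 j - b c x i 1 * g c x 0 j) : R^o)) => //.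
    move=> x cx; have [e00 e01 e10 e11] := @eps2E R.
    by rewrite [RHS]mxE !mulmx2E e00 e01 e10 e11; congr (_ * _); ring.
  apply: smooth_onM => //.
    apply: smooth_onV => //.
      by move=> x cx; rewrite mulr_gt0// sqrtr_gt0 d0.
    apply: smooth_onM => //; first exact: smooth_on_cst.
    apply: smooth_on_sqrt => //; first by move=> x cx; exact: d0.
    exact: det_qcoef_smooth.
  by apply: smooth_onB => //; apply: smooth_onM.
Qed.

End invariant_forms.

(* [P] and [Q] are the entries of the traceless shape operator, so that the
   metric is [rho] times ((C - s P, - s Q), (- s Q, C + s P)); [V] is the Codazzi
   expression. *)
Lemma codazzi_identity (R : fieldType) (rho P Q C s u sp fp : R)
    (drho dP dQ : 'I_2 -> R) :
  let du i := 2 * (P * dP i + Q * dQ i) in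
  let b j k := if j == k then (if j == 0 then P else - P) else Q in
  let db i j k := if j == k then (if j == 0 then dP i else - dP i) else dQ i in
  let de (j k : 'I_2) := if j == k then 1 else 0 in
  let dg i j k := drho i * (C * de j k - s * b j k)
     + rho * (fp * s * du i * de j k - sp * du i * b j k - s * db i j k) in
  let gV k l := (C * de k l + s * b k l) / rho in
  let Gam k i j := 2^-1 * (gV k 0 * (dg i j 0 + dg j i 0 - dg 0 i j)
     + gV k 1 * (dg i j 1 + dg j i 1 - dg 1 i j)) in
  let V k := db 0 1 k + fp * du 0 * de 1 k - (db 1 0 k + fp * du 1 * de 0 k)
     + (Gam k 0 0 * b 1 0 + Gam k 0 1 * b 1 1)
     - (Gam k 1 0 * b 0 0 + Gam k 1 1 * b 0 1) in
  (2 : R) != 0 -> rho != 0 -> u = P ^+ 2 + Q ^+ 2 ->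
  C ^+ 2 - u * s ^+ 2 = 1 -> 2 * u * sp + s = 2 * C * fp ->
  rho * V 0 = (drho 0 * Q + rho * dQ 0) - (drho 1 * P + rho * dP 1) /\
  rho * V 1 = - ((drho 0 * P + rho * dP 0) + (drho 1 * Q + rho * dQ 1)).
Proof.
move=> du b db de dg gV Gam V n2 rho0 -> e1 e2.
pose E1 := C ^+ 2 - (P ^+ 2 + Q ^+ 2) * s ^+ 2 - 1.
pose E2 := 2 * (P ^+ 2 + Q ^+ 2) * sp + s - 2 * C * fp.
have E10 : E1 = 0 by rewrite /E1 e1 subrr.
have E20 : E2 = 0 by rewrite /E2 e2 subrr.
pose U0 := P * dP 0 + Q * dQ 0; pose U1 := P * dP 1 + Q * dQ 1.
split.
(* The defects [E1], [E2] of the two relations appear with explicit cofactors; this makes the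
   identity free of side relations, so that [field] can check it. *)
- transitivity ((drho 0 * Q + rho * dQ 0) - (drho 1 * P + rho * dP 1)
    + E2 * rho * (- s * Q * U0 + (s * P + C) * U1)
    + E1 * (2 * fp * rho * U1 + Q * drho 0 - P * drho 1)); last by rewrite E10 E20; ring.
  rewrite /V /Gam /gV /dg /de /db /b /du /E1 /E2 /U0 /U1 /=.
  move: (drho 0) (drho 1) (dP 0) (dP 1) (dQ 0) (dQ 1) => *.
  by field; rewrite rho0 n2.
- transitivity (- ((drho 0 * P + rho * dP 0) + (drho 1 * Q + rho * dQ 1))
    + E2 * rho * ((s * P - C) * U0 + s * Q * U1)
    + E1 * (- 2 * fp * rho * U0 - P * drho 0 - Q * drho 1)); last by rewrite E10 E20; ring.
  rewrite /V /Gam /gV /dg /de /db /b /du /E1 /E2 /U0 /U1 /=.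
  move: (drho 0) (drho 1) (dP 0) (dP 1) (dQ 0) (dQ 1) => *.
  by field; rewrite rho0 n2.
Qed.

(** The conclusion is the pair of Cauchy-Riemann equations of [rho * p - i * rho * q], with the
    product rule expanded. [fp] and [sp] are the derivatives of [f] and [s] with respect to [u]; [C]
    has derivative [fp * s]. The metric has determinant [rho ^+ 2], which makes its inverse, and so
    its Christoffel symbols, explicit. *)
Lemma codazzi_divergence (R : realType) (S : surface R) (P : fundamental_pair S)
    (c : chart R S) (x : 'rV[R]_2) (rho p q C s h : 'rV[R]_2 -> R^o) (u sp fp : R)
    (drho dp dq : 'I_2 -> R) :
  let du i := 2 * (p x * dp i + q x * dq i) in
  codazzi_pair P -> atlas c -> cimg c x ->
  (forall i, is_derive x 'e_i rho (drho i)) ->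
  (forall i, is_derive x 'e_i p (dp i)) ->
  (forall i, is_derive x 'e_i q (dq i)) ->
  (forall i, is_derive x 'e_i C (fp * s x * du i)) ->
  (forall i, is_derive x 'e_i s (sp * du i)) ->
  (forall i, is_derive x 'e_i h (fp * du i)) ->
  (forall y, cimg c y -> [/\ formI P c y 0 0 = rho y * (C y - s y * p y),
     formI P c y 0 1 = - (rho y * (s y * q y)) &
     formI P c y 1 1 = rho y * (C y + s y * p y)]) ->
  (forall y, cimg c y -> [/\ Defs.shape P c y 0 0 = h y + p y,
     Defs.shape P c y 0 1 = q y, Defs.shape P c y 1 0 = q y &
     Defs.shape P c y 1 1 = h y - p y]) ->
  rho x != 0 -> u = p x ^+ 2 + q x ^+ 2 -> C x ^+ 2 - u * s x ^+ 2 = 1 ->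
  2 * u * sp + s x = 2 * C x * fp ->
  drho 0 * q x + rho x * dq 0 = drho 1 * p x + rho x * dp 1 /\
  drho 0 * p x + rho x * dp 0 = - (drho 1 * q x + rho x * dq 1).
Proof.
move=> du cod ac cx drhoP dpP dqP dCP dsP dhP gE SE rho0 uE Cs2 spE.
have oc : open (cimg c) by exact: cimg_open.
pose de (j k : 'I_2) : R := if j == k then 1 else 0.
pose b (j k : 'I_2) : R := if j == k then (if j == 0 then p x else - p x) else q x.
pose db (i j k : 'I_2) : R := if j == k then (if j == 0 then dp i else - dp i) else dq i.
pose dg (i j k : 'I_2) : R := drho i * (C x * de j k - s x * b j k)
     + rho x * (fp * s x * du i * de j k - sp * du i * b j k - s x * db i j k).
have dgE i j k : 'D_('e_i) (fun y => formI P c y j k : R^o) x = dg i j k.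
  have near_D (G : 'rV[R]_2 -> R^o) (l : R) :
      (forall y, cimg c y -> formI P c y j k = G y) -> is_derive x 'e_i G l ->
      'D_('e_i) (fun y => formI P c y j k : R^o) x = l.
    move=> FG [_ <-]; apply: near_eq_derive.
    exact: (open_near oc cx FG).
  have g0 : is_derive x 'e_i (rho * (C - s * p)) (dg i 0 0).
    apply: is_derive_eq; rewrite /dg /de /b /db /=.
    rewrite /GRing.scale/= !fctE.
    move: (rho x) (C x) (s x) (p x) (q x) (drho i) (dp i) (dq i) (du i) => *; ring.
  have g1 : is_derive x 'e_i (- (rho * (s * q))) (dg i 0 1).
    apply: is_derive_eq; rewrite /dg /de /b /db /=.
    rewrite /GRing.scale/= !fctE.
    move: (rho x) (C x) (s x) (p x) (q x) (drho i) (dp i) (dq i) (du i) => *; ring.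
  have g3 : is_derive x 'e_i (rho * (C + s * p)) (dg i 1 1).
    have := is_deriveM (drhoP i) (is_deriveD (dCP i) (is_deriveM (dsP i) (dpP i))).
    move=> /is_derive_eq; apply; rewrite /dg /de /b /db /=.
    rewrite /GRing.scale/= !fctE.
    move: (rho x) (C x) (s x) (p x) (q x) (drho i) (dp i) (dq i) (du i) => *; ring.
  have g2 : dg i 1 0 = dg i 0 1 by [].
  elim/ord2P: j near_D; elim/ord2P: k => near_D.
  - by apply: near_D g0 => y /gE[].
  - by apply: near_D g1 => y /gE[].
  - by rewrite g2; apply: near_D g1 => y cy; rewrite qcoef10//; case: (gE y cy).
  - by apply: near_D g3 => y /gE[].
pose gV k l := (C x * de k l + s x * b k l) / rho x.
have gVE k l : invmx (formI P c x) k l = gV k l.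
  have [g00 g01 g11] := gE x cx; have g10 := qcoef10 (formI P) ac cx.
  have dE : \det (formI P c x) = rho x ^+ 2.
    rewrite det2 g10 g00 g01 g11 -[RHS]mulr1 -Cs2 uE; ring.
  have d0 : \det (formI P c x) != 0 by rewrite dE expf_neq0.
  have [] := invmx2 d0; rewrite dE g10 g00 g01 g11.
  elim/ord2P: k; elim/ord2P: l; rewrite /gV /de /b /= => i00 i01 i10 i11.
  - by rewrite i00; field.
  - by rewrite i01; field.
  - by rewrite i10; field.
  - by rewrite i11; field.
pose Gam k i j := 2^-1 *
    (gV k 0 * (dg i j 0 + dg j i 0 - dg 0 i j) + gV k 1 * (dg i j 1 + dg j i 1 - dg 1 i j)).
have cE k i j : christoffel (formI P c) k i j x = Gam k i j.
  by rewrite /christoffel sum_ord2 !gVE !dgE.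
have GamC k : Gam k 1 0 = Gam k 0 1.
  by rewrite /Gam [dg 1 0 0 + _]addrC [dg 1 0 1 + _]addrC.
have SD i j k : 'D_('e_i) (fun y => Defs.shape P c y j k : R^o) x =
    db i j k + fp * du i * de j k.
  have near_D (G : 'rV[R]_2 -> R^o) (l : R) :
      (forall y, cimg c y -> Defs.shape P c y j k = G y) -> is_derive x 'e_i G l ->
      'D_('e_i) (fun y => Defs.shape P c y j k : R^o) x = l.
    move=> FG [_ <-]; apply: near_eq_derive.
    exact: (open_near oc cx FG).
  have s0 : is_derive x 'e_i (h + p) (db i 0 0 + fp * du i * de 0 0).
    by apply: is_derive_eq; rewrite /db /de /=; ring.
  have s1 : is_derive x 'e_i q (db i 0 1 + fp * du i * de 0 1).
    by apply: is_derive_eq; rewrite /db /de /=; ring.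
  have s3 : is_derive x 'e_i (h - p) (db i 1 1 + fp * du i * de 1 1).
    by apply: is_derive_eq; rewrite /db /de /=; ring.
  have s2 : db i 1 0 + fp * du i * de 1 0 = db i 0 1 + fp * du i * de 0 1 by [].
  elim/ord2P: j near_D; elim/ord2P: k => near_D.
  - by apply: near_D s0 => y /SE[].
  - by apply: near_D s1 => y /SE[].
  - by rewrite s2; apply: near_D s1 => y /SE[].
  - by apply: near_D s3 => y /SE[].
have n2 : (2 : R) != 0 by rewrite pnatr_eq0.
pose V k := db 0 1 k + fp * du 0 * de 1 k - (db 1 0 k + fp * du 1 * de 0 k)
     + (Gam k 0 0 * b 1 0 + Gam k 0 1 * b 1 1)
     - (Gam k 1 0 * b 0 0 + Gam k 1 1 * b 0 1).
have Sx j k : Defs.shape P c x j k = h x * de j k + b j k.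
  have [S00 S01 S10 S11] := SE x cx.
  by elim/ord2P: j; elim/ord2P: k; rewrite ?S00 ?S01 ?S10 ?S11 /de /b /=; ring.
have V0 k : V k = 0.
  rewrite -(codazzi_pointwise k cod ac cx) !SD !cE !Sx /V GamC.
  rewrite /de /=; move: (Gam k 0 0) (Gam k 0 1) (Gam k 1 1) => G00 G01 G11; ring.
have [] : rho x * V 0 = drho 0 * q x + rho x * dq 0 - (drho 1 * p x + rho x * dp 1) /\
    rho x * V 1 = - (drho 0 * p x + rho x * dp 0 + (drho 1 * q x + rho x * dq 1)).
  exact: (@codazzi_identity R (rho x) (p x) (q x) (C x) (s x) u sp fp drho dp dq
    n2 rho0 uE Cs2 spE).
rewrite !V0 !mulr0 => /esym/subr0_eq -> /esym/eqP; rewrite oppr_eq0 addr_eq0 => /eqP ->.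
by [].
Qed.

(** * Holomorphy *)

Section complex_differentiability.
Context {R : realType}.
Local Open Scope complex_scope.

Lemma normc_le_sum (x y : R) : `|x +i* y| <= (`|x| + `|y|)%:C.
Proof.
rewrite normc_def lecR /=.
rewrite -[leRHS]ger0_norm ?addr_ge0// -sqrtr_sqr ler_wsqrtr//.
rewrite sqrrD !real_normK ?num_real// -addrA [_ *+ 2 + _]addrC addrA lerDl.
by rewrite mulrn_wge0// mulr_ge0.
Qed.

Lemma plane_point_norm (z : R[i]) : (`|plane_point z|)%:C <= `|z|.
Proof.
rewrite normc_def lecR; apply: rV2_norm_le; rewrite ?sqrtr_ge0// !mxE/=.
  by rewrite -sqrtr_sqr ler_wsqrtr// lerDl sqr_ge0.
by rewrite -sqrtr_sqr ler_wsqrtr// lerDr sqr_ge0.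
Qed.

Lemma plane_pointD (z w : R[i]) : plane_point (z + w) = plane_point z + plane_point w.
Proof. by case: z w => [a b] [c d]; apply/rowP; apply: ord2P; rewrite !mxE. Qed.

Lemma derive_plane_point (a : 'rV[R]_2 -> R^o) (x : 'rV[R]_2) (h : R[i]) :
  differentiable a x ->
  'd a x (plane_point h) = complex.Re h * 'D_('e_0) a x + complex.Im h * 'D_('e_1) a x.
Proof.
move=> da; rewrite !deriveE//.
have -> : plane_point h = complex.Re h *: 'e_0 + complex.Im h *: 'e_1.
  by apply/rowP; apply: ord2P; rewrite !mxE/= ?mulr0 ?mulr1 ?addr0 ?add0r.
by rewrite linearD/= !linearZ/=.
Qed.

Lemma cauchy_riemann_derivable (a b : 'rV[R]_2 -> R^o) (z : R[i]) :
  differentiable a (plane_point z) -> differentiable b (plane_point z) ->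
  'D_('e_0) a (plane_point z) = 'D_('e_1) b (plane_point z) ->
  'D_('e_1) a (plane_point z) = - 'D_('e_0) b (plane_point z) ->
  derivable ((fun w => a (plane_point w) +i* b (plane_point w)) : R[i]^o -> R[i]^o) z 1.
Proof.
move=> da db E1 E2; set x := plane_point z.
pose L := 'D_('e_0) a x +i* 'D_('e_0) b x.
set q := (fun w => _ +i* _).
apply/cvg_ex; exists (L : R[i]^o).
apply/cvgrPdist_le => /= e e0. 
(* The tolerance is an element of [R[i]]; being positive, it is real. *)
have [r r0 er] : exists2 r : R, 0 < r & e = r%:C.
  case: e e0 => er ei; rewrite ltcE /= => /andP[/eqP -> er0].
  by exists er.
have r2 : 0 < r / 2 by rewrite divr_gt0.
have [d1 /= d10 Ha] : nbhs_ball (0 : 'rV[R]_2)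
    (fun k => `|a (k + x) - a x - 'd a x k| <= r / 2 * `|k|).
  exact/nbhs_ballP/(differentiable_bound da r2).
have [d2 /= d20 Hb] : nbhs_ball (0 : 'rV[R]_2)
    (fun k => `|b (k + x) - b x - 'd b x k| <= r / 2 * `|k|).
  exact/nbhs_ballP/(differentiable_bound db r2).
exists (Num.min d1 d2)%:C => /=; first by rewrite ltcR lt_min d10.
move=> h; rewrite /ball_ /= sub0r normrN => hd h0.
have kh := plane_point_norm h.
have kd : `|plane_point h| < Num.min d1 d2.
  by rewrite -ltcR; exact: le_lt_trans kh hd.
move: kd; rewrite lt_min => /andP[kd1 kd2].
have {}Ha := Ha (plane_point h); have {}Hb := Hb (plane_point h).
rewrite -ball_normE /ball_ /= sub0r normrN in Ha Hb.
have {}Ha := Ha kd1; have {}Hb := Hb kd2.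
have -> : L - h^-1 *: (q (h *: 1 + z) - q z) = - ((q (h + z) - q z - L * h) / h).
  by rewrite /GRing.scale/= mulr1; field.
rewrite normrN normrM normfV ler_pdivrMr ?normr_gt0//.
have -> : q (h + z) - q z - L * h =
   (a (plane_point h + x) - a x - 'd a x (plane_point h)) +i*
   (b (plane_point h + x) - b x - 'd b x (plane_point h)).
  rewrite !derive_plane_point// /q plane_pointD -/x.
  rewrite E2 -E1 /L; case: h {h0 hd kh kd1 kd2 Ha Hb} => h1 h2.
  move: (a _) (a x) (b _) (b x) ('D_('e_0) a x) ('D_('e_0) b x) => *.
  by apply/eqP; rewrite eq_complex /=; apply/andP; split; apply/eqP; ring.
rewrite (le_trans (normc_le_sum _ _))// er.
apply: (@le_trans _ _ (r * `|plane_point h|)%:C).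
  by have := lerD Ha Hb; rewrite -mulrDl -splitr -lecR; exact.
have rr : (r * `|plane_point h|)%:C = r%:C * (`|plane_point h|)%:C by exact: rmorphM.
have r0C : 0 <= r%:C by rewrite lecR ltW.
by rewrite rr; exact: (@ler_wpM2l _ r%:C r0C _ _ kh).
Qed.

End complex_differentiability.

(** Being traceless for a multiple of the identity leaves only two free entries, those of the real
    part of a multiple of [dz ^ 2]; the other clauses transport the facts on [metric_part] and
    [hopf_part] to these entries. *)
Lemma conformal_deformation (F : fieldType) (g b0 : 'M[F]_2) (C s u rho : F) :
  g^T = g -> b0^T = b0 -> \det g != 0 -> mixed_det g b0 = 0 ->
  \det b0 = - u * \det g -> C ^+ 2 - u * s ^+ 2 = 1 -> rho != 0 ->
  metric_part g b0 C s = rho%:M ->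
  let B := hopf_part g b0 C s u in
  [/\ B 1 0 = B 0 1, B 1 1 = - B 0 0, B 0 0 ^+ 2 + B 0 1 ^+ 2 = u * rho ^+ 2,
      b0 *m invmx g = rho^-1 *: B & b0 *m eps2 *m g = rho *: (B *m eps2)].
Proof.
move=> sg sb0 g0 tb db Csu rho0 AE B.
have B10 : B 1 0 = B 0 1 by rewrite !mxE (sym2 sg) (sym2 sb0).
have dg : \det g = rho ^+ 2.
  by rewrite -(det_metric_part sg sb0 tb db Csu) AE det_scalar.
have B11 : B 1 1 = - B 0 0.
  have := mixed_metric_hopf C s sg sb0 tb db; rewrite AE /mixed_det !mxE/= -/B.
  rewrite mulr0n !mulr1n mulr0 mul0r subr0 -mulrDr => /eqP.
  by rewrite mulf_eq0 (negbTE rho0) addr_eq0 => /eqP.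
split=> //.
- have := det_hopf_part sg sb0 tb db Csu; rewrite -/B det2 B10 B11 dg => dB.
  by rewrite -[RHS]opprK -mulNr -dB; ring.
- have := hopf_shape C s sg sb0 g0 tb db; rewrite -/B AE mul_mx_scalar => ->.
  by rewrite scalerA mulVf// scale1r.
- by rewrite -(hopf_eps2_metric sg sb0 tb db Csu) AE mul_mx_scalar.
Qed.

(** The eigenvalues of [b] for [g] are the two square roots of [v], which bounds [b 0 0 ^+ 2] by
    [v * g 0 0 ^+ 2]; and [k ^+ 2] exceeds [v * s ^+ 2] by 1. Together with the determinant this
    makes the deformed form positive definite. *)
Lemma metric_part_gt0 (F : realFieldType) (g b : 'M[F]_2) (k s v : F) :
  g^T = g -> b^T = b -> 0 < g 0 0 -> 0 < \det g -> mixed_det g b = 0 ->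
  \det b = - v * \det g -> k ^+ 2 - v * s ^+ 2 = 1 -> 0 < k ->
  0 < metric_part g b k s 0 0.
Proof.
move=> sg sb g00 + + + + k0; rewrite /mixed_det /metric_part !mxE !det2 (sym2 sg) (sym2 sb).
set W := g 0 0 * _ - _ => W0 tb db Cs.
(* A sum of squares that replaces diagonalisation: it is obtained by eliminating [b 1 1] with the
   trace condition [tb]. *)
have u0 : v * g 0 0 ^+ 2 * W = (g 0 0 * b 0 1 - b 0 0 * g 0 1) ^+ 2 + W * b 0 0 ^+ 2.
  have -> : v * g 0 0 ^+ 2 * W = - g 0 0 ^+ 2 * (b 0 0 * b 1 1 - b 0 1 * b 0 1).
    by rewrite db; ring.
  by rewrite -[LHS]addr0 -(mulr0 (g 0 0 * b 0 0)) -tb /W; ring.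
have le2 : b 0 0 ^+ 2 <= v * g 0 0 ^+ 2.
  by rewrite -(ler_pM2l W0) [leRHS]mulrC u0 lerDr sqr_ge0.
have lt2 : (s * b 0 0) ^+ 2 < (k * g 0 0) ^+ 2.
  rewrite exprMn (@le_lt_trans _ _ (s ^+ 2 * (v * g 0 0 ^+ 2)))//.
    by rewrite ler_wpM2l// sqr_ge0.
  rewrite exprMn mulrA ltr_pM2r ?exprn_gt0// -subr_gt0.
  have -> : k ^+ 2 - s ^+ 2 * v = 1 by rewrite -Cs; ring.
  exact: ltr01.
have kg : 0 < k * g 0 0 by rewrite mulr_gt0.
have : `|s * b 0 0| < k * g 0 0.
  rewrite -(@ltr_pXn2r _ 2)// ?nnegrE ?(ltW kg)//.
  by rewrite real_normK ?num_real.
by rewrite ltr_norml => /andP[+ _]; rewrite ltrNl -subr_gt0 opprK addrC.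
Qed.

(** * Special Weingarten pairs *)

Section weingarten_pair.
Context {R : realType} (S : surface R) (J : set R) (f phi : R -> R).
Hypothesis J_interval : nondegenerate_interval J.
Hypothesis J_ge0 : J `<=` [set s | 0 <= s].
Hypothesis f_smooth : smooth_within J f.
Hypothesis phi_primitive : primitive_within [set t : R | 0 <= t /\ J (t ^+ 2)]
  (fun t => 2 * derive_within J f (t ^+ 2)) phi.
Hypothesis phi_ratio : J 0 -> cvg (sinh (phi s) / s @[s --> 0^'+]).
Variable P : fundamental_pair S.
Hypothesis P_weingarten : special_weingarten_pair J f P.
Implicit Types (c : chart R S) (x : 'rV[R]_2).

Local Notation H := (mean_curvature P).
Local Notation C := (cosh_coef phi).
Local Notation sh := (sinh_coef phi).

Definition skew_curvature c x : R := H c x ^+ 2 - extrinsic_curvature P c x.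
Definition traceless_II c x := formII P c x - H c x *: formI P c x.

Local Notation u := skew_curvature.

Let Csh := cosh_coef2 J_interval J_ge0 phi_primitive phi_ratio.
Let dC := within_deriv_cosh_coef J_interval J_ge0 f_smooth phi_primitive phi_ratio.
Let CC n := @cosh_coef_within_C R J f phi J_interval J_ge0 f_smooth
  phi_primitive phi_ratio n.
Let CS n := sinh_coef_within_C J_interval J_ge0 f_smooth phi_primitive phi_ratio (CC n).

Lemma skew_curvature_in c x : atlas c -> cimg c x -> J (u c x).
Proof. by move=> ac cx; have [_ /(_ c x ac cx)[]] := P_weingarten. Qed.

Lemma mean_curvatureE c x : atlas c -> cimg c x -> H c x = f (u c x).
Proof. by move=> ac cx; have [_ /(_ c x ac cx)[]] := P_weingarten. Qed.

Lemma deformation_data c x : atlas c -> cimg c x ->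
  [/\ (formI P c x)^T = formI P c x, (traceless_II c x)^T = traceless_II c x,
      0 < \det (formI P c x), mixed_det (formI P c x) (traceless_II c x) = 0 &
      \det (traceless_II c x) = - u c x * \det (formI P c x)].
Proof.
move=> ac cx; have [_ d0] := metric_gt0 (formI_metric P) ac cx.
have n2 : (2 : R) != 0 by rewrite pnatr_eq0.
have sI := qcoef_sym (formI P) ac cx; have sII := qcoef_sym (formII P) ac cx.
split=> //.
- by rewrite /traceless_II linearB/= linearZ/= sI sII.
- by apply: traceless_mixed_det; rewrite ?gt_eqF.
- by apply: det_traceless; rewrite ?gt_eqF.
Qed.

Lemma coef_identity c x : atlas c -> cimg c x ->
  C (u c x) ^+ 2 - u c x * sh (u c x) ^+ 2 = 1.
Proof. by move=> ac cx; apply: Csh; exact: skew_curvature_in. Qed.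

Lemma skew_curvature_field : scalar_field u.
Proof.
apply: scalar_fieldB; last exact: extrinsic_curvature_field.
exact: scalar_fieldM (mean_curvature_field P) (mean_curvature_field P).
Qed.

Lemma cosh_coef_field : scalar_field (fun c x => C (u c x)).
Proof.
apply: (@scalar_field_comp _ _ J) => //; first exact: skew_curvature_field.
exact: skew_curvature_in.
Qed.

Lemma sinh_coef_field : scalar_field (fun c x => sh (u c x)).
Proof.
apply: (@scalar_field_comp _ _ J) => //; first exact: skew_curvature_field.
exact: skew_curvature_in.
Qed.

(** [A], [B], [T] are the metric and the real and imaginary parts of Q. Writing the first two as
    combinations of [I] and [II] with invariant smooth coefficients gives smoothness and the
    transformation law at once, also at umbilics. *)
Lemma deformation_forms : exists A B T : quadratic_form S,
  [/\ forall c x, A c x =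
        metric_part (formI P c x) (traceless_II c x) (C (u c x)) (sh (u c x)),
      forall c x, B c x =
        2^-1 *: hopf_part (formI P c x) (traceless_II c x) (C (u c x)) (sh (u c x)) (u c x) &
      forall c x, atlas c -> cimg c x ->
        T c x = (2 * Num.sqrt (\det (formI P c x)))^-1
          *: (traceless_II c x *m eps2 *m formI P c x)].
Proof.
have fH := mean_curvature_field P; have fC := cosh_coef_field.
have fS := sinh_coef_field; have fu := skew_curvature_field.
have k := @scalar_field_cst _ S.
have [A AE] := quadratic_combination (formI P) (formII P)
  (scalar_fieldB fC (scalar_fieldM fS fH)) fS.
have [B BE] := quadratic_combination (formI P) (formII P)
  (scalar_fieldM (k 2^-1) (scalar_fieldB (scalar_fieldM fu fS) (scalar_fieldM fC fH)))
  (scalar_fieldM (k 2^-1) fC).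
have [b0 b0E] := quadratic_combination (formI P) (formII P)
  (scalar_fieldM (k (-1)) fH) (k 1).
have b0T c x : b0 c x = traceless_II c x.
  by rewrite b0E mulN1r scaleNr scale1r addrC.
have [|T TE] := @quadratic_rotation _ _ (formI P) b0 (formI_metric P).
  by move=> c x ac cx; rewrite b0T; have [] := deformation_data ac cx.
exists A, B, T; split=> [c x|c x|c x ac cx].
- by rewrite AE /metric_part /traceless_II; apply/matrixP => i j; rewrite !mxE; ring.
- by rewrite BE /hopf_part /traceless_II; apply/matrixP => i j; rewrite !mxE; ring.
- by rewrite TE b0T.
Qed.

Local Notation metric c x :=
  (metric_part (formI P c x) (traceless_II c x) (C (u c x)) (sh (u c x))).
Local Notation hopf c x :=
  (hopf_part (formI P c x) (traceless_II c x) (C (u c x)) (sh (u c x)) (u c x)).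

Lemma metric_posdef c x : atlas c -> cimg c x ->
  0 < metric c x 0 0 /\ 0 < \det (metric c x).
Proof.
move=> ac cx; have [sg sb d0 tb db] := deformation_data ac cx.
have Cs := coef_identity ac cx; have [g00 _] := metric_gt0 (formI_metric P) ac cx.
split; last by rewrite (det_metric_part sg sb tb db Cs).
have C0 : 0 < C (u c x).
  by rewrite /cosh_coef /cosh divr_gt0// addr_gt0// expR_gt0.
by apply: (metric_part_gt0 sg sb g00 d0 tb db Cs C0).
Qed.

Lemma conformal_chart c x : atlas c -> cimg c x -> is_scalar_mx (metric c x) ->
  let rho := metric c x 0 0 in
  [/\ 0 < rho, metric c x = rho%:M & \det (formI P c x) = rho ^+ 2].
Proof.
move=> ac cx /is_scalar_mxP[r mE] rho; have [sg sb d0 tb db] := deformation_data ac cx.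
have Cs := coef_identity ac cx; have [rho0 _] := metric_posdef ac cx.
have rE : rho = r by rewrite /rho mE mxE eqxx mulr1n.
split=> //; first by rewrite rE.
by rewrite -(det_metric_part sg sb tb db Cs) mE det_scalar rE.
Qed.

Lemma conformal_data c x : atlas c -> cimg c x -> is_scalar_mx (metric c x) ->
  let rho := metric c x 0 0 in let B := hopf c x in
  [/\ B 1 0 = B 0 1, B 1 1 = - B 0 0, B 0 0 ^+ 2 + B 0 1 ^+ 2 = u c x * rho ^+ 2,
      Defs.shape P c x = (H c x)%:M + rho^-1 *: B &
      traceless_II c x *m eps2 *m formI P c x = rho *: (B *m eps2)].
Proof.
move=> ac cx mc rho B; have [sg sb d0 tb db] := deformation_data ac cx.
have Cs := coef_identity ac cx; have [rho0 mE dE] := conformal_chart ac cx mc.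
have [B10 B11 BB BS BT] :=
  conformal_deformation sg sb (lt0r_neq0 d0) tb db Cs (lt0r_neq0 rho0) mE.
split=> //; rewrite -BS /traceless_II mulmxBl -scalemxAl mulmxV.
  by rewrite scalemx1 addrC subrK.
by rewrite unitmxE unitfE gt_eqF.
Qed.

Lemma hopf_cauchy_riemann c x : atlas c ->
  (forall y, cimg c y -> is_scalar_mx (metric c y)) -> cimg c x ->
  'D_('e_0) (fun y => hopf c y 0 1 : R^o) x = 'D_('e_1) (fun y => hopf c y 0 0 : R^o) x /\
  'D_('e_0) (fun y => hopf c y 0 0 : R^o) x = - 'D_('e_1) (fun y => hopf c y 0 1 : R^o) x.
Proof.
move=> ac mc cx; have oc : open (cimg c) by exact: cimg_open.
have [A [_ [_ [AE _ _]]]] := deformation_forms.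
pose rho y : R^o := metric c y 0 0.
(* In this chart the traceless shape operator is ((p, q), (q, -p)). Its entries are smooth and
   satisfy [u = p ^+ 2 + q ^+ 2], so that [u] can be differentiated without its square root. *)
pose p y : R^o := Defs.shape P c y 0 0 - H c y.
pose q y : R^o := Defs.shape P c y 0 1.
have rhoA : rho = (fun y => A c y 0 0) by apply/funext => y; rewrite AE.
have data y : cimg c y -> [/\ rho y != 0, hopf c y 0 0 = rho y * p y,
    hopf c y 0 1 = rho y * q y, u c y = p y ^+ 2 + q y ^+ 2 &
    [/\ Defs.shape P c y 0 0 = H c y + p y, Defs.shape P c y 0 1 = q y,
     Defs.shape P c y 1 0 = q y & Defs.shape P c y 1 1 = H c y - p y]].
  move=> cy; have [B10 B11 BB SE _] := conformal_data ac cy (mc y cy).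
  have [rho0 _ _] := conformal_chart ac cy (mc y cy).
  have {}rho0 : rho y != 0 by rewrite gt_eqF.
  move: B10 B11 BB SE; rewrite /p /q -/(rho y).
  move: (Defs.shape P c y) (u c y) (rho y) (H c y) rho0 (hopf c y) => Sy v r h r0 By.
  move=> B10 B11 BB ->; rewrite !mxE/= !mulr1n !mulr0n !add0r B10 B11 (addrC h) addrK.
  split=> //; first by rewrite mulVKf.
  - by rewrite mulVKf.
  - by rewrite !exprMn -mulrDr BB exprVn mulrC mulfK// expf_neq0.
  - by split=> //; rewrite ?mulrN addrC.
pose drho i := 'D_('e_i) rho x; pose dp i := 'D_('e_i) p x; pose dq i := 'D_('e_i) q x.
have frho : differentiable rho x.
  by rewrite rhoA; exact: (smooth_on_differentiable (qcoef_smooth A 0 0 ac) cx).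
have sS j k := shape_smooth P j k ac.
have fp : differentiable p x.
  apply: (smooth_on_differentiable _ cx); apply: smooth_onB => //.
  exact: (mean_curvature_field P).2.
have fq : differentiable q x by exact: (smooth_on_differentiable (sS 0 1) cx).
have fu : differentiable (u c : _ -> R^o) x.
  exact: (smooth_on_differentiable (skew_curvature_field.2 c ac) cx).
have du i : 'D_('e_i) (u c : _ -> R^o) x = 2 * (p x * dp i + q x * dq i).
  have E y : cimg c y -> (u c : _ -> R^o) y = (p * p + q * q) y.
    by move=> /data[_ _ _ -> _].
  rewrite (near_eq_derive _ (open_near oc cx E)).
  have fpp : derivable (p * p) x 'e_i by apply: diff_derivable; exact: differentiableM.
  have fqq : derivable (q * q) x 'e_i by apply: diff_derivable; exact: differentiableM.
  rewrite (deriveD fpp fqq) !deriveM; do ?exact: diff_derivable.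
  by rewrite /GRing.scale/= -/(dp i) -/(dq i); ring.
have Ju := skew_curvature_in ac cx.
have nJ : \forall y \near x, J (u c y).
  by apply: (open_near oc cx) => y; exact: skew_curvature_in.
have comp (F : R -> R) (l : R) i : within_deriv J F (u c x) l ->
    is_derive x 'e_i (fun y => F (u c y) : R^o) (l * (2 * (p x * dp i + q x * dq i))).
  move=> Fl; have [dF FE] := differentiable_within_comp nJ fu Fl.
  split; first exact: diff_derivable.
  by rewrite (deriveE _ dF) FE -du (deriveE _ fu).
have [S' SS' S'E] := sinh_coef_derive J_interval J_ge0 f_smooth phi_primitive phi_ratio.
(* The Weingarten relation enters the differential equations here: it makes the differential of H
   equal to [f'(u)] times that of [u]. *)
have dH i : is_derive x 'e_i (H c : _ -> R^o)
    (derive_within J f (u c x) * (2 * (p x * dp i + q x * dq i))).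
  have E y : cimg c y -> f (u c y) = H c y by move=> cy; rewrite mean_curvatureE.
  have fl : within_deriv J f (u c x) (derive_within J f (u c x)) by exact: (@f_smooth 0%N _ Ju).
  have nE : \forall y \near x, f (u c y) = H c y by exact: (open_near oc cx E).
  exact: near_eq_is_derive nE (comp f _ i fl).
have gE y : cimg c y -> [/\ formI P c y 0 0 = rho y * (C (u c y) - sh (u c y) * p y),
     formI P c y 0 1 = - (rho y * (sh (u c y) * q y)) &
     formI P c y 1 1 = rho y * (C (u c y) + sh (u c y) * p y)].
  move=> cy; have [_ B00 B01 _ _] := data y cy.
  have [_ B11 _ _ _] := conformal_data ac cy (mc y cy).
  have [_ mE _] := conformal_chart ac cy (mc y cy).
  have gK := metric_partK (formI P c y) (traceless_II c y) (coef_identity ac cy).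
  have gij i j : formI P c y i j = C (u c y) * metric c y i j - sh (u c y) * hopf c y i j.
    by rewrite -[in LHS]gK; move: (metric c y) (hopf c y) => m h; rewrite !mxE.
  have m01 : metric c y 0 1 = 0 by rewrite mE mxE.
  have m11 : metric c y 1 1 = rho y by rewrite mE mxE.
  by rewrite !gij B11 B00 B01 m01 m11 -/(rho y); split; ring.
have [rho0 _ _ uE _] := data x cx.
have ddrho i : is_derive x 'e_i rho (drho i) by exact/derivableP/diff_derivable.
have ddp i : is_derive x 'e_i p (dp i) by exact/derivableP/diff_derivable.
have ddq i : is_derive x 'e_i q (dq i) by exact/derivableP/diff_derivable.
have SE y (cy : cimg c y) := let: And5 _ _ _ _ SE := data y cy in SE.
have dCu i : is_derive x 'e_i (fun y => C (u c y) : R^o)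
    (derive_within J f (u c x) * sh (u c x) * (2 * (p x * dp i + q x * dq i))).
  exact: comp (dC Ju).
have dSu i : is_derive x 'e_i (fun y => sh (u c y) : R^o)
    (S' (u c x) * (2 * (p x * dp i + q x * dq i))) by exact: comp (SS' _ Ju).
have [T0 T1] := codazzi_divergence P_weingarten.1 ac cx ddrho ddp ddq dCu dSu dH gE SE
  rho0 uE (coef_identity ac cx) (S'E _ Ju).
have hopfD i k (h : 'rV[R]_2 -> R^o) : differentiable h x ->
    (forall y, cimg c y -> hopf c y 0 k = rho y * h y) ->
    'D_('e_i) (fun y => hopf c y 0 k : R^o) x = drho i * h x + rho x * 'D_('e_i) h x.
  move=> fh E; rewrite (near_eq_derive _ (open_near oc cx E)).
  rewrite [LHS](@deriveM _ _ rho h); do ?exact: diff_derivable.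
  by rewrite /GRing.scale/= -/(drho i); ring.
have D0 i := hopfD i 0 p fp (fun y cy => let: And5 _ e _ _ _ := data y cy in e).
have D1 i := hopfD i 1 q fq (fun y cy => let: And5 _ _ e _ _ := data y cy in e).
by rewrite !D0 !D1.
Qed.

End weingarten_pair.

(** * Complex quadratic forms in a conformal parameter *)

Section complex_forms.
Context {R : realType} (S : surface R).
Local Open Scope complex_scope.

Lemma ccoefE (Q : complex_form (S := S)) c x i j :
  ccoef Q c x i j = form_re Q c x i j +i* form_im Q c x i j.
Proof.
rewrite /ccoef /complex_mx; move: (form_re Q c x) (form_im Q c x) => B T.
by rewrite !mxE; apply/eqP; rewrite eq_complex /=; apply/andP; split; apply/eqP; ring.
Qed.

Lemma dz2E : [/\ dz2 0 0 = 1 :> R[i], dz2 0 1 = 'i%C :> R[i], dz2 1 0 = 'i%C :> R[i] &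
  dz2 1 1 = -1 :> R[i]].
Proof.
rewrite /dz2 /dz; split; rewrite !mxE big_ord1 !mxE /=; rewrite ?mul1r ?mulr1//.
by apply/eqP; rewrite eq_complex /=; apply/andP; split; apply/eqP; ring.
Qed.

(** The off-diagonal entry of [dz2] is [i], so the real part of [i q] is minus the imaginary part of
    [q]; this fixes the sign of [B 0 1]. *)
Lemma traceless_dz2 (B T : 'M[R]_2) : B 1 0 = B 0 1 -> B 1 1 = - B 0 0 ->
  T = B *m eps2 ->
  forall i j, B i j +i* T i j = (B 0 0 +i* - B 0 1) * dz2 i j.
Proof.
move=> B10 B11 ->; have [z00 z01 z10 z11] := dz2E; have [e00 e01 e10 e11] := @eps2E R.
apply: ord2P; apply: ord2P;
  rewrite ?z00 ?z01 ?z10 ?z11 mulmx2E ?B10 ?B11 ?e00 ?e01 ?e10 ?e11;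
  by apply/eqP; rewrite eq_complex /=; apply/andP; split; apply/eqP; ring.
Qed.

End complex_forms.

(** * The metric, the holomorphic differential and the function t on the surface *)

Local Open Scope complex_scope.

Theorem corollary4 (R : realType) (S : surface R) (J : set R) (f phi : R -> R)
  (J_interval : nondegenerate_interval J)
  (J_ge0 : J `<=` [set s | 0 <= s])
  (f_smooth : smooth_within J f)
  (phi_primitive :
    primitive_within [set t : R | 0 <= t /\ J (t ^+ 2)]
      (fun t => 2 * derive_within J f (t ^+ 2)) phi)
  (phi_ratio : J 0 -> cvg (sinh (phi s) / s @[s --> 0^'+]))
  (P : fundamental_pair S)
  (P_weingarten : special_weingarten_pair J f P) :
  exists (A : quadratic_form S) (Q : complex_form (S := S)) (t : S -> R),
    [/\ riemannian_metric A,
        holomorphic_differential A Q,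
        (forall p, 0 <= t p /\ J (t p ^+ 2)),
        norm_ratio A Q t &
        forall c x, atlas c -> cimg c x ->
          let s := t (cinv c x) in
          let H := mean_curvature P c x in
          let K := extrinsic_curvature P c x in
          [/\ complex_mx (formI P c x)
                = - (sinh_ratio phi s)%:C *: ccoef Q c x
                  + (cosh (phi s))%:C *: complex_mx (A c x)
                  - (sinh_ratio phi s)%:C *: conj_mx (ccoef Q c x),
              complex_mx (formII P c x - f (s ^+ 2) *: formI P c x)
                = (cosh (phi s))%:C *: ccoef Q c x
                  - (s * sinh (phi s))%:C *: complex_mx (A c x)
                  + (cosh (phi s))%:C *: conj_mx (ccoef Q c x) &
              s ^+ 2 = H ^+ 2 - K] ].
Proof.
have Ju := skew_curvature_in P_weingarten.
have [A [B [T [AE BE TE]]]] := deformation_forms J_interval J_ge0 f_smooth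
  phi_primitive phi_ratio P_weingarten.
have posdef := metric_posdef J_interval J_ge0 phi_primitive phi_ratio P_weingarten.
have conf_chart := conformal_chart J_interval J_ge0 phi_primitive phi_ratio P_weingarten.
have conf_data := conformal_data J_interval J_ge0 phi_primitive phi_ratio P_weingarten.
(* [t] must depend on the point alone, whereas curvatures depend on a chart and coordinates. A chart
   is chosen at every point, and invariance of [H^2 - K] makes the choice immaterial in [tE]. *)
have [cp acp cpp] : exists2 cp : S -> chart R S,
    forall p, atlas (cp p) & forall p, cdom (cp p) p.
  have H (p : S) := cid2 (atlas_cover p).
  by exists (fun p => s2val (H p)) => p; case: (H p).
pose t (p : S) := Num.sqrt (skew_curvature P (cp p) (cmap (cp p) p)).
have u_ge0 c x : atlas c -> cimg c x -> 0 <= skew_curvature P c x.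
  by move=> ac cx; apply: J_ge0; exact: Ju.
have tE c x : atlas c -> cimg c x -> t (cinv c x) = Num.sqrt (skew_curvature P c x).
  move=> ac cx; rewrite /t; set d := cp _; congr Num.sqrt.
  have [inv _] := skew_curvature_field P.
  by rewrite (inv c d)//; [exact: acp|apply/overlapP; split=> //; exact: cpp].
pose Q := @ComplexForm _ S B T.
have QE c x : atlas c -> cimg c x -> (exists lambda, A c x = (2 * lambda)%:M) ->
    forall i j, ccoef Q c x i j = (B c x 0 0 +i* - B c x 0 1) * dz2 i j.
  move=> ac cx [l Al]; have [sI _ d0 _ _] := deformation_data P ac cx.
  have mc : is_scalar_mx (metric_part (formI P c x) (traceless_II P c x)
      (cosh_coef phi (skew_curvature P c x)) (sinh_coef phi (skew_curvature P c x))).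
    by rewrite -AE Al scalar_mx_is_scalar.
  have [rho0 _ dE] := conf_chart c x ac cx mc.
  have [B10 B11 _ _ bT] := conf_data c x ac cx mc.
  move=> i j; rewrite ccoefE; apply: traceless_dz2.
  - by rewrite /= BE; move: (hopf_part _ _ _ _ _) B10 => h B10; rewrite !mxE B10.
  - by rewrite /= BE; move: (hopf_part _ _ _ _ _) B11 => h B11; rewrite !mxE B11 mulrN.
  - rewrite /= TE// BE bT dE sqrtr_sqr ger0_norm ?(ltW rho0)// scalerA -scalemxAl.
    by congr (_ *: _); field; rewrite gt_eqF.
exists A, Q, t; split.
- move=> c x v ac cx; move: v; apply/(posdef2P (qcoef_sym A ac cx)).
  by rewrite AE; exact: posdef.
- move=> c [ac Ac].
  (* The coefficient of [dz ^ 2] is [B 0 0 - i * B 0 1]. Both Cauchy-Riemann equations are known for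
     [hopf_part], which is twice [B], hence the cancellations of 2 below. *)
  pose a (y : 'rV[R]_2) : R^o := B c y 0 0; pose b (y : 'rV[R]_2) : R^o := - B c y 0 1.
  exists (fun z => a (plane_point z) +i* b (plane_point z)).
    move=> z cz; set x := plane_point z.
    have sB k : smooth_on (cimg c) (fun y => B c y 0 k : R^o) by exact: qcoef_smooth.
    have fB k : differentiable (fun y => B c y 0 k : R^o) x.
      exact: (smooth_on_differentiable (sB k) cz).
    have hB k i : 'D_('e_i) (fun y => hopf_part (formI P c y) (traceless_II P c y)
        (cosh_coef phi (skew_curvature P c y)) (sinh_coef phi (skew_curvature P c y))
        (skew_curvature P c y) 0 k : R^o) x = 2 * 'D_('e_i) (fun y => B c y 0 k : R^o) x.
      rewrite -[RHS](@deriveZ _ _ _ (fun y => B c y 0 k : R^o)); last exact: diff_derivable.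
      congr ('D_('e_i) _ x); apply/funext => y; rewrite /= BE.
      by move: (hopf_part _ _ _ _ _) => h; rewrite mxE /GRing.scale/=; field.
    have mc y : cimg c y -> is_scalar_mx (metric_part (formI P c y) (traceless_II P c y)
        (cosh_coef phi (skew_curvature P c y)) (sinh_coef phi (skew_curvature P c y))).
      by move=> /Ac[l Al]; rewrite -AE Al scalar_mx_is_scalar.
    have := hopf_cauchy_riemann J_interval J_ge0 f_smooth phi_primitive phi_ratio
      P_weingarten ac mc cz.
    rewrite !hB => -[CR1 CR2].
    have n2 : (2 : R) != 0 by rewrite pnatr_eq0.
    have bD i : 'D_('e_i) b x = - 'D_('e_i) (fun y => B c y 0 1 : R^o) x.
      by apply: deriveN; exact: diff_derivable.
    apply: cauchy_riemann_derivable.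
    - exact: fB.
    - exact: differentiableN (fB 1).
    - by apply: (mulfI n2); rewrite bD mulrN -CR2.
    - by apply: (mulfI n2); rewrite bD opprK -CR1.
  move=> z cz; apply/matrixP => i j; rewrite QE//; last exact: Ac.
  by rewrite [RHS]mxE.
- move=> p; rewrite /t sqrtr_ge0; have cx : cimg (cp p) (cmap (cp p) p) by exists p.
  by rewrite sqr_sqrtr; [split=> //; exact: Ju|exact: u_ge0].
- move=> c x l q [ac Ac] cx Al Qq; rewrite tE//.
  have mc : is_scalar_mx (metric_part (formI P c x) (traceless_II P c x)
      (cosh_coef phi (skew_curvature P c x)) (sinh_coef phi (skew_curvature P c x))).
    by rewrite -AE Al scalar_mx_is_scalar.
  have [rho0 _ _] := conf_chart c x ac cx mc.
  have [_ _ BB _ _] := conf_data c x ac cx mc.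
  move: rho0 BB; rewrite -AE Al mxE/= mulr1n => l0 BB.
  have {}l0 : 0 < l by rewrite pmulr_rgt0 in l0.
  (* The given [q] is arbitrary; comparing the entries at (0, 0), where [dz2] is 1, identifies
     it. *)
  have qE : q = B c x 0 0 +i* - B c x 0 1.
    have [z00 _ _ _] := @dz2E R.
    have := QE c x ac cx (Ac x cx) 0 0; rewrite Qq mxE z00 !mulr1 => <-.
    by [].
  (* Two factors 4 cancel: the conformal factor of [A] is [2 * l], and [B] is half of
     [hopf_part]. *)
  have Bq : B c x 0 0 ^+ 2 + (- B c x 0 1) ^+ 2 = skew_curvature P c x * l ^+ 2.
    move: BB; rewrite BE; move: (hopf_part _ _ _ _ _) => h BB.
    rewrite !mxE; apply: (@mulfI _ 4); first by rewrite pnatr_eq0.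
    transitivity (h 0 0 ^+ 2 + h 0 1 ^+ 2); first by field.
    by rewrite BB; ring.
  rewrite qE normc_def /= Bq sqrtrM ?u_ge0// sqrtr_sqr (ger0_norm (ltW l0)).
  have l0C : l%:C != 0 by apply/eqP => -[] /eqP; rewrite gt_eqF.
  by rewrite rmorphM/= mulfK.
- move=> c x ac cx s H K.
  have sE : s = Num.sqrt (skew_curvature P c x) by exact: tE.
  have s2 : s ^+ 2 = skew_curvature P c x by rewrite sE sqr_sqrtr// u_ge0.
  have s0 : 0 <= s by rewrite sE sqrtr_ge0.
  have Ch : cosh (phi s) = cosh_coef phi (skew_curvature P c x) by rewrite sE.
  have Sh : sinh_ratio phi s = sinh_coef phi (skew_curvature P c x) by rewrite sE.
  (* The coefficient [t sinh phi(t)] of the second formula is [u] times the smooth coefficient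
     [sinh_coef], at umbilics as well. *)
  have sSh : s * sinh (phi s) = skew_curvature P c x * sinh_coef phi (skew_curvature P c x).
    have Js : J (s ^+ 2) by rewrite s2; exact: Ju.
    rewrite -(mulr_sinh_coef J_interval J_ge0 phi_primitive phi_ratio s0 Js) s2.
    by rewrite mulrA -expr2 s2.
  have Csh := coef_identity J_interval J_ge0 phi_primitive phi_ratio P_weingarten ac cx.
  have hI := metric_partK (formI P c x) (traceless_II P c x) Csh.
  have hII := hopf_partK (formI P c x) (traceless_II P c x) Csh.
  have HE : H = f (s ^+ 2) by rewrite s2; exact: (mean_curvatureE P_weingarten).
  have cc : ccoef Q c x = \matrix_(i, j) (B c x i j +i* T c x i j).
    by apply/matrixP => i j; rewrite ccoefE mxE.
  have hB : hopf_part (formI P c x) (traceless_II P c x)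
        (cosh_coef phi (skew_curvature P c x)) (sinh_coef phi (skew_curvature P c x))
        (skew_curvature P c x) = 2 *: B c x.
    by rewrite BE scalerA mulfV ?scale1r// pnatr_eq0.
  rewrite -AE hB in hI hII; rewrite -HE Ch Sh sSh cc.
  split; last by rewrite s2.
  - rewrite -hI; move: (A c x) (B c x) (T c x) => a b w.
    by apply/matrixP => i j; rewrite !mxE; apply/eqP; rewrite eq_complex /=;
      apply/andP; split; apply/eqP; ring.
  - rewrite -/(traceless_II P c x) -hII; move: (A c x) (B c x) (T c x) => a b w.
    by apply/matrixP => i j; rewrite !mxE; apply/eqP; rewrite eq_complex /=;
      apply/andP; split; apply/eqP; ring.
Qed.
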